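(* The Rhombic dodecahedron, Triakis octahedron, Tetrakis hexahedron, Deltoidal icositetrahedron, Disdyakis dodecahedron, Rhombic triacontahedron, Triakis icosahedron, Pentakis dodecahedron and Disdyakis triacontahedron all have Rupert's property.
   Context: A polyhedron $\mathbf{P}$ is a finite set of points of $\mathbb{R}^3$ (its vertices) in convex position and non-degenerate (not all contained in a plane); $\overline{\mathbf{P}}$ denotes its convex hull. A set with a hole is a subset of $\mathbb{R}^3$ whose interior is connected but not simply connected. $\mathbf{P}$ has Rupert's property (is Rupert) if there are a polyhedron $\mathbf{Q}$ of the same shape and size as (i.e. congruent to) $\mathbf{P}$ and a direction vector $v\in\mathbb{R}^3\setminus\{0\}$ such that $\overline{\mathbf{P}}\setminus\{q+tv: q\in\overline{\mathbf{Q}},\ t\in\mathbb{R}\}$ is a set with a hole. Notation: $T_{x,y}:\mathbb{R}^2\to\mathbb{R}^2$ is the translation by $(x,y)^t$; $R_\alpha:\mathbb{R}^2\to\mathbb{R}^2$ is the counter-clockwise rotation about the origin by the angle $\alpha$; and $M_{\theta,\varphi}:\mathbb{R}^3\to\mathbb{R}^2$ is the linear map with matrix $\begin{pmatrix}-\sin\theta&\cos\theta&0\\-\cos\theta\cos\varphi&-\sin\theta\cos\varphi&\sin\varphi\end{pmatrix}$. These maps act on sets elementwise. For a finite set $\mathcal{Q}\subset\mathbb{R}^2$, $\mathcal{Q}^\circ$ is the interior of its convex hull. Equivalently to the definition above, $\mathbf{P}$ is Rupert iff there are $x,y\in\mathbb{R}$, $\alpha,\theta_1,\theta_2\in[0,2\pi)$,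 $\varphi_1,\varphi_2\in[0,\pi]$ with $(T_{x,y}\circ R_\alpha\circ M_{\theta_1,\varphi_1})(\mathbf{P})\subset M_{\theta_2,\varphi_2}(\mathbf{P})^\circ$. (The property is invariant under similarities.) The listed polyhedra are Catalan solids, i.e. duals of Archimedean solids. Up to similarity, each is the vertex set of the polar dual $\{y\in\mathbb{R}^3:\langle x,y\rangle\le 1\ \text{for all } x\in\mathbf{A}\}$ of the Archimedean solid $\mathbf{A}$ listed next, where $\Phi=(1+\sqrt5)/2$ and all choices of signs are allowed: - Rhombic dodecahedron: dual of the Cuboctahedron, all permutations of $(\pm1,\pm1,0)$. - Triakis octahedron: dual of the Truncated cube, all permutations of $(\pm1,\pm1,\pm(\sqrt2-1))$. - Tetrakis hexahedron: dual of the Truncated octahedron, all permutations of $(0,\pm1,\pm2)$. - Deltoidal icositetrahedron: dual of the Rhombicuboctahedron, all permutations of $(\pm1,\pm1,\pm(1+\sqrt2))$. - Disdyakis dodecahedron: dual of the Truncated cuboctahedron, all permutations of $(\pm1,\pm(1+\sqrt2),\pm(1+2\sqrt2))$. - Rhombic triacontahedron: dual of the Icosidodecahedron, all permutations of $(0,0,\pm\Phi)$ and all even permutations of $(\pm\frac12,\pm\frac\Phi2,\pm\frac{\Phi^2}2)$. - Triakis icosahedron: dual of the Truncated dodecahedron, all even permutations of $(0,\pm\frac1\Phi,\pm(2+\Phi))$, $(\pm\frac1\Phi,\pm\Phi,\pm2\Phi)$ and $(\pm\Phi,\pm2,\pm(\Phi+1))$. - Pentakis dodecahedron: dual of the Truncated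 icosahedron, all odd permutations of $(0,\pm1,\pm3\Phi)$, $(\pm1,\pm(2+\Phi),\pm2\Phi)$ and $(\pm\Phi,\pm2,\pm(2\Phi+1))$. - Disdyakis triacontahedron: dual of the Truncated icosidodecahedron, all even permutations of $(\pm\frac1\Phi,\pm\frac1\Phi,\pm(3+\Phi))$, $(\pm\frac2\Phi,\pm\Phi,\pm(1+2\Phi))$, $(\pm\frac1\Phi,\pm\Phi^2,\pm(-1+3\Phi))$, $(\pm(2\Phi-1),\pm2,\pm(2+\Phi))$ and $(\pm\Phi,\pm3,\pm2\Phi)$. *)

(* Defs.v *)
From HB Require Import structures.
From mathcomp Require Import all_boot all_order all_fingroup all_algebra.
From mathcomp Require Import all_classical all_reals all_analysis.

Set Implicit Arguments.
Unset Strict Implicit.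
Unset Printing Implicit Defensive.

Import Order.TTheory GRing.Theory Num.Theory.
Import numFieldNormedType.Exports.

Local Open Scope classical_set_scope.
Local Open Scope ring_scope.

(* Points of R^3 are row vectors.  The library norm on 'rV[R]_3 is the sup norm:
   it only provides the topology here, Euclidean notions being expressed through
   [dot] and orthogonal matrices. *)

Section Geometry.
Variable R : realType.
Implicit Types (x y v : 'rV[R]_3) (A K P Q : set 'rV[R]_3) (k : R).

Definition dot x y : R := \sum_(i < 3) x 0 i * y 0 i.

Definition convex_hull A : set 'rV[R]_3 := smallest (@convex_set R _) A.

Definition polyhedron P : Prop :=
  [/\ finite_set P,
      forall p, P p -> ~ convex_hull (P `\ p) p
    & ~ exists n : 'rV[R]_3, exists2 c : R, n != 0 & forall p, P p -> dot n p = c].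

(* M ranges over all orthogonal matrices, so reflections are allowed. *)
Definition similar_ratio k P Q : Prop :=
  exists (M : 'M[R]_3) (t : 'rV[R]_3),
    M *m M^T = 1%:M /\ Q = [set k *: (x *m M) + t | x in P].

Definition congruent P Q : Prop := similar_ratio 1 P Q.

Definition tube Q v : set 'rV[R]_3 :=
  [set x | exists q, exists2 t : R, convex_hull Q q & x = q + t *: v].

End Geometry.

Section SimplyConnected.
Variables (R : realType) (T : topologicalType).
Implicit Types (A : set T) (g : R -> T) (H : R * R -> T).

Definition path_in A g : Prop :=
  {within `[0, 1], continuous g} /\ (forall t : R, t \in `[0, 1] -> A (g t)).

Definition null_homotopic A g : Prop :=
  exists H,
    [/\ {within `[0, 1] `*` `[0, 1], continuous H},
        forall s t : R, s \in `[0, 1] -> t \in `[0, 1] -> A (H (s, t)),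
        forall t : R, t \in `[0, 1] -> H (0, t) = g t /\ H (1, t) = g 0
      & forall s : R, s \in `[0, 1] -> H (s, 0) = g 0 /\ H (s, 1) = g 0].

(* The empty set is simply connected for this definition, hence is not the
   interior of a set with a hole. *)
Definition simply_connected A : Prop :=
  (forall x y, A x -> A y -> exists g, [/\ path_in A g, g 0 = x & g 1 = y]) /\
  (forall g, path_in A g -> g 0 = g 1 -> null_homotopic A g).

End SimplyConnected.

Section Rupert.
Variable R : realType.
Implicit Types (A K P Q : set 'rV[R]_3).

Definition has_hole A : Prop :=
  connected A° /\ ~ simply_connected R A°.

(* In particular P itself is a polyhedron, being congruent to Q. *)
Definition rupert P : Prop :=
  exists Q (v : 'rV[R]_3),
    [/\ polyhedron Q, congruent P Q, v != 0
      & has_hole (convex_hull P `\` tube Q v)].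

Definition polar_dual A : set 'rV[R]_3 :=
  [set y | forall x, A x -> dot x y <= 1].

(* The vertices of a polytope are its extreme points. *)
Definition vertices K : set 'rV[R]_3 :=
  [set y | K y /\ forall a b (t : R), K a -> K b -> 0 < t < 1 ->
                  y = t *: a + (1 - t) *: b -> a = b].

(* A solid is only determined up to similarity. *)
Definition dual_solid A P : Prop :=
  exists2 k : R, 0 < k & similar_ratio k (vertices (polar_dual A)) P.

End Rupert.

Section Solids.
Variable R : realType.

Definition signed_perms (E : pred 'S_3) (a b c : R) : set 'rV[R]_3 :=
  [set x | exists s : 'S_3, exists2 e : {ffun 'I_3 -> bool},
     E s & x = \row_(i < 3) ((-1) ^+ e i * [:: a; b; c]`_(s i))].

(* As s and its inverse have the same parity, it does not matter whether
   s acts on the coordinates or on their indices. *)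
Definition all_perms : R -> R -> R -> set 'rV[R]_3 :=
  signed_perms predT.
Definition even_perms : R -> R -> R -> set 'rV[R]_3 :=
  signed_perms [pred s : 'S_3 | ~~ odd_perm s].
Definition odd_perms : R -> R -> R -> set 'rV[R]_3 :=
  signed_perms [pred s : 'S_3 | odd_perm s].

Definition golden_ratio : R := (1 + Num.sqrt 5) / 2.
Local Notation sqrt2 := (Num.sqrt 2 : R).
Local Notation Phi := golden_ratio.

Definition cuboctahedron := all_perms 1 1 0.
Definition truncated_cube := all_perms 1 1 (sqrt2 - 1).
Definition truncated_octahedron := all_perms 0 1 2.
Definition rhombicuboctahedron := all_perms 1 1 (1 + sqrt2).
Definition truncated_cuboctahedron := all_perms 1 (1 + sqrt2) (1 + 2 * sqrt2).
Definition icosidodecahedron :=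
  all_perms 0 0 Phi `|` even_perms (1 / 2) (Phi / 2) (Phi ^+ 2 / 2).
Definition truncated_dodecahedron :=
  even_perms 0 (1 / Phi) (2 + Phi)
  `|` even_perms (1 / Phi) Phi (2 * Phi)
  `|` even_perms Phi 2 (Phi + 1).
Definition truncated_icosahedron :=
  odd_perms 0 1 (3 * Phi)
  `|` odd_perms 1 (2 + Phi) (2 * Phi)
  `|` odd_perms Phi 2 (2 * Phi + 1).
Definition truncated_icosidodecahedron :=
  even_perms (1 / Phi) (1 / Phi) (3 + Phi)
  `|` even_perms (2 / Phi) Phi (1 + 2 * Phi)
  `|` even_perms (1 / Phi) (Phi ^+ 2) (- 1 + 3 * Phi)
  `|` even_perms (2 * Phi - 1) 2 (2 + Phi)
  `|` even_perms Phi 3 (2 * Phi).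

Definition rhombic_dodecahedron := dual_solid cuboctahedron.
Definition triakis_octahedron := dual_solid truncated_cube.
Definition tetrakis_hexahedron := dual_solid truncated_octahedron.
Definition deltoidal_icositetrahedron := dual_solid rhombicuboctahedron.
Definition disdyakis_dodecahedron := dual_solid truncated_cuboctahedron.
Definition rhombic_triacontahedron := dual_solid icosidodecahedron.
Definition triakis_icosahedron := dual_solid truncated_dodecahedron.
Definition pentakis_dodecahedron := dual_solid truncated_icosahedron.
Definition disdyakis_triacontahedron := dual_solid truncated_icosidodecahedron.

End Solids.

(* Main.v *)
(* The solids are centrally symmetric polar duals K, so no translation is needed: it is
   enough to find a rotation N and a direction v such that, seen along v, K N lies in the
   interior of K. This is certified by a polygon whose vertices are projections of interior
   points of K and whose edges strictly bound K N; the bound on each edge is a nonnegative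
   combination of three of the inequalities defining K, so the vertices of K are never
   needed. Everything is checked exactly in Z[sqrt 2] or Z[sqrt 5]. The complement of the
   tube in the interior of K is connected, and the lifted polygon winds around the tube,
   hence is not null-homotopic, which a discrete winding number shows. *)

(* A passage with room to spare survives small perturbations. The rotation and the direction can
   therefore be rational and the polygon vertices rounded towards the inside, so that only strict
   inequalities and identities in a real quadratic ring remain, decided by integer arithmetic. The
   obstacle is topological: the hole is defined through the interior of [K] minus the tube, which is
   the interior of [K] minus the closure of the tube. The argument is therefore made for abstract
   sets [O] and [C] with the few properties that survive closure (invariance along [v], star shape,
   a strict bound at each edge); this is why each edge bound comes with a constant strictly below
   the required value. Of simple connectedness only the clause on loops is refuted. Labels in {0, 1,
   2} replace the angle: signs of linear forms and a compactness argument then suffice, without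
   lifting paths to a covering. Since [P] is any similar copy of the dual, the hole is built for [K]
   itself and moved to [P] by a homeomorphism. *)
Require Import Defs.
From Stdlib Require Import ZArith.
From HB Require Import structures.
From mathcomp Require Import all_boot all_order all_fingroup all_algebra.
From mathcomp Require Import all_classical all_reals all_analysis.
From mathcomp Require Import ssrZ zify lra ring.

Set Implicit Arguments.
Unset Strict Implicit.
Unset Printing Implicit Defensive.

Import Order.TTheory GRing.Theory Num.Theory.
Import numFieldNormedType.Exports.

Local Open Scope classical_set_scope.
Local Open Scope ring_scope.

(** * A discrete winding number *)

(* [turn a b] is the representative of [b - a] modulo 3 in {-1, 0, 1}; around a square
   that misses one of the three labels it is a coboundary. *)
Definition turn (a b : nat) : int :=
  if a == b then 0 else if b == (a.+1 %% 3)%N then 1 else -1.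

Lemma turn_square (k a b c d : nat) :
  (a < 3)%N -> (b < 3)%N -> (c < 3)%N -> (d < 3)%N -> (k < 3)%N ->
  a != k -> b != k -> c != k -> d != k ->
  turn a b + turn b d = turn a c + turn c d.
Proof.
by move: a b c d k => [|[|[|a]]] [|[|[|b]]] [|[|[|c]]] [|[|[|d]]] // [|[|[|k]]].
Qed.

(** Here [m] and [n] play the role of lifted labels: along a lift that advances by at most 1 at each
    step, the total turn telescopes to the difference of the end values. *)
Lemma turn_mod3 (m n : nat) : (m <= n)%N -> (n <= m.+1)%N ->
  turn (m %% 3) (n %% 3) = n%:Z - m%:Z.
Proof.
move=> mn; rewrite leq_eqVlt => /orP[/eqP->|]; last first.
  rewrite ltnS => nm; have -> : n = m by apply/eqP; rewrite eqn_leq nm.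
  by rewrite /turn eqxx subrr.
have -> : (m.+1 %% 3 = (m %% 3).+1 %% 3)%N by rewrite -addn1 -modnDml addn1.
rewrite intS addrK /turn eqxx.
have : (m %% 3 < 3)%N by rewrite ltn_mod.
by case: (m %% 3)%N => [|[|[|?]]].
Qed.

Section Winding.
Variables (R : realType) (T : topologicalType) (S : set T).
Variables (f0 f1 f2 : T -> R).
Hypotheses (cf0 : continuous f0) (cf1 : continuous f1).
Hypothesis f_sum : forall x, f0 x + f1 x + f2 x = 0.
Hypothesis f_neq0 : forall x, S x -> ~ [/\ f0 x = 0, f1 x = 0 & f2 x = 0].

(* If f0, f1, f2 are three linear forms on the plane with sum 0, this labels the three
   half-open sectors cut out by their kernels. *)
Definition sector (x : T) : nat :=
  if (0 <= f0 x) && (f1 x < 0) then 0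
  else if (0 <= f1 x) && (f2 x < 0) then 1 else 2.

Lemma sector_lt3 x : (sector x < 3)%N.
Proof. by rewrite /sector; case: ifP => // _; case: ifP. Qed.

(** A strict sign persists nearby and excludes a label: [f0 < 0] excludes 0, [f1 < 0] excludes 1,
    [f1 > 0] excludes 0, and [f0 > 0] excludes 2, since label 2 would then force [f1 >= 0] and
    [f2 >= 0] against the zero sum. If [f0] and [f1] both vanish, so does [f2], which cannot happen
    on [S]. *)
Lemma sector_missed x : S x -> exists2 k : nat, (k < 3)%N & \forall z \near x, sector z != k.
Proof.
have opn (f : T -> R) (cf : continuous f) : (0 < f x -> \forall z \near x, 0 < f z) /\
    (f x < 0 -> \forall z \near x, f z < 0).
  by split=> fx; [exact: (cvgr_gt _ (cf x))|exact: (cvgr_lt _ (cf x))].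
move=> Sx.
have sec z := f_sum z.
have [f0x|f0x|f0x] := ltgtP (f0 x) 0.
- exists 0%N => //; near=> z.
  have fz : f0 z < 0 by near: z; apply: (opn _ cf0).2.
  by rewrite /sector leNgt fz /=; case: ifP.
- exists 2%N => //; near=> z.
  have fz : 0 < f0 z by near: z; apply: (opn _ cf0).1.
  rewrite /sector (ltW fz) /=; case: ltP => //= f1z.
  by case: ltP => // f2z; have := sec z; lra.
have [f1x|f1x|f1x] := ltgtP (f1 x) 0.
- exists 1%N => //; near=> z.
  have fz : f1 z < 0 by near: z; apply: (opn _ cf1).2.
  by rewrite /sector (leNgt 0 (f1 z)) fz /=; case: ifP.
- exists 0%N => //; near=> z.
  have fz : 0 < f1 z by near: z; apply: (opn _ cf1).1.
  by rewrite /sector [f1 z < 0]ltNge (ltW fz) andbF; case: ifP.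
exfalso; apply: (f_neq0 Sx); split => //.
by have := sec x; lra.
Unshelve. all: end_near. Qed.

(* On a fine grid in the square, no cell sees all three labels, so the total turn along
   a row does not depend on the row; it is 3 on the first row and 0 on the last one. *)
Lemma winding_not_null (g : R -> T) (a b : R) :
  0 < a -> a < b -> b < 1 -> g 1 = g 0 ->
  (forall t : R, 0 <= t < a -> 0 <= f0 (g t) /\ f1 (g t) < 0) ->
  (forall t : R, a <= t < b -> 0 <= f1 (g t) /\ f2 (g t) < 0) ->
  (forall t : R, b <= t < 1 -> 0 <= f2 (g t) /\ f0 (g t) < 0) ->
  ~ null_homotopic S g.
Proof.
move=> a0 ab b1 g10 ga gb gc [H [cH SH H0 H1]].
pose D : set (R * R) := `[0, 1] `*` `[0, 1].
have cD : compact D by apply: compact_setX; exact: segment_compact.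
(* A Lebesgue number argument: around each point some small cell misses a label, and compactness of
   the square makes the size of the cell uniform. *)
pose P (n : nat) (p : R * R) := exists2 k : nat, (k < 3)%N & forall q, D q ->
  `|p.1 - q.1| <= n.+1%:R^-1 -> `|p.2 - q.2| <= n.+1%:R^-1 -> sector (H q) != k.
have nP : \forall n \near \oo, D `<=` P n.
  move/compact_near_coveringP/near_covering_withinP : cD; apply.
  move=> p Dp.
  have [k k3 kP] : exists2 k : nat, (k < 3)%N & \forall z \near H p, sector z != k.
    by apply: sector_missed; case: p Dp => s t [/= s01 t01]; apply: SH.
  have /subspace_continuousP/(_ _ Dp) cHp := cH.
  have : \forall q \near within D (nbhs p), sector (H q) != k by exact: (cHp _ kP).
  rewrite near_withinE => /nbhs_ballP[e /= e0 eP].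
  have e20 : 0 < e / 2 by rewrite divr_gt0.
  near=> x n => Dx; exists k => // q Dq q1 q2.
  have n0 : n.+1%:R^-1 < e / 2.
    by near: n; apply: (near_infty_natSinv_lt (PosNum e20)).
  have [x1 x2] : ball p (e / 2) x by near: x; apply: nbhsx_ballx.
  move: x1 x2; rewrite /ball /= => x1 x2.
  apply: eP => //=; split; rewrite /ball /=.
    have -> : p.1 - q.1 = (p.1 - x.1) + (x.1 - q.1) by rewrite addrA subrK.
    by rewrite (le_lt_trans (ler_normD _ _))// (splitr e) ltrD// (le_lt_trans q1).
  have -> : p.2 - q.2 = (p.2 - x.2) + (x.2 - q.2) by rewrite addrA subrK.
  by rewrite (le_lt_trans (ler_normD _ _))// (splitr e) ltrD// (le_lt_trans q2).
(* The mesh is also finer than each of the three arcs of the loop, so that consecutive grid points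
   of the first row never skip a label. *)
have : \forall n \near \oo, [/\ D `<=` P n, n.+1%:R^-1 < a,
    n.+1%:R^-1 < b - a & n.+1%:R^-1 < 1 - b].
  have ba0 : 0 < b - a by rewrite subr_gt0.
  have b10 : 0 < 1 - b by rewrite subr_gt0.
  near=> n; split; near: n => //.
  - exact: (near_infty_natSinv_lt (PosNum a0)).
  - exact: (near_infty_natSinv_lt (PosNum ba0)).
  - exact: (near_infty_natSinv_lt (PosNum b10)).
move=> /filter_ex[n [DP na nba nb1]].
set N : nat := n.+1 in na nba nb1.
pose x (i : nat) : R := i%:R / N%:R.
have N0 : 0 < N%:R :> R by rewrite ltr0n.
have x0 : x 0%N = 0 by rewrite /x mul0r.
have xN : x N = 1 by rewrite /x divff// gt_eqF.
have xS i : x i.+1 = x i + N%:R^-1 by rewrite /x -natr1 mulrDl mul1r.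
have x01 i : (i <= N)%N -> x i \in `[0, 1].
  by move=> iN; rewrite in_itv/= /x divr_ge0//= ler_pdivrMr// mul1r ler_nat.
pose L i j := sector (H (x i, x j)).
have square i j : (i < N)%N -> (j < N)%N ->
    turn (L i j) (L i j.+1) + turn (L i j.+1) (L i.+1 j.+1) =
    turn (L i j) (L i.+1 j) + turn (L i.+1 j) (L i.+1 j.+1).
  move=> iN jN.
  have [k k3 kP] : P n (x i, x j) by apply: DP; split; apply: x01; exact: ltnW.
  have stp u v : (u <= v <= u.+1)%N -> `|x u - x v| <= N%:R^-1.
    move=> /andP[uv]; rewrite leq_eqVlt ltnS => /orP[/eqP->|vu].
      by rewrite xS opprD addrA subrr sub0r normrN ger0_norm// invr_ge0 ltW.
    have -> : v = u by apply/eqP; rewrite eqn_leq uv vu.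
    by rewrite subrr normr0 invr_ge0 ltW.
  apply: (turn_square (k := k)) => //; try exact: sector_lt3;
    apply: kP => /=; try (by apply: stp; rewrite ?leqnn ?leqnSn);
    by split; apply: x01 => //; exact: ltnW.
(* The sides [t = 0] and [t = 1] of the square are sent to [g 0]; turns along them vanish, so
   summing the cell identities equates consecutive rows. *)
have side i j : (i <= N)%N -> (j == 0%N) || (j == N) -> L i j = sector (g 0).
  move=> iN; have [H00 H01] := H1 _ (x01 _ iN).
  by move=> /orP[] /eqP->; rewrite /L ?x0 ?xN ?H00 ?H01.
have turnxx c : turn c c = 0 by rewrite /turn eqxx.
pose W i := \sum_(0 <= j < N) turn (L i j) (L i j.+1).
have WS i : (i < N)%N -> W i = W i.+1.
  move=> iN; suff rec M : (M <= N)%N -> \sum_(0 <= j < M) turn (L i j) (L i j.+1)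
      + turn (L i M) (L i.+1 M) =
      turn (L i 0) (L i.+1 0) + \sum_(0 <= j < M) turn (L i.+1 j) (L i.+1 j.+1).
    have := rec N (leqnn _).
    rewrite !side ?eqxx ?orbT//; try exact: ltnW.
    by rewrite !turnxx addr0 add0r.
  elim: M => [|M IH] MN; first by rewrite !big_geq// addr0 add0r.
  rewrite !big_nat_recr//= -addrA square// addrA IH; last exact: ltnW.
  by rewrite addrA.
have WN : W 0%N = W N.
  suff rec M : (M <= N)%N -> W 0%N = W M by exact: rec.
  by elim: M => [//|M IH] MN; rewrite IH; [exact: WS|exact: ltnW].
have W10 : W N = 0.
  rewrite /W big_nat big1// => j /andP[_ jN].
  have H0N i : (i <= N)%N -> H (x N, x i) = g 0.
    by move=> iN; rewrite xN; have [] := H0 _ (x01 _ iN).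
  by rewrite /L !H0N//; exact: ltnW.
(* [lam] lifts the labels of the first row. At [t = 1], where the loop is back at label 0, it takes
   the value 3: this last step completes the turn. *)
pose lam (t : R) : nat := if t < a then 0 else if t < b then 1 else if t < 1 then 2 else 3.
have Llam j : (j <= N)%N -> L 0%N j = (lam (x j) %% 3)%N.
  move=> jN; have xj := x01 _ jN.
  have -> : L 0%N j = sector (g (x j)).
    by rewrite /L x0; have [->] := H0 _ xj.
  move: xj; rewrite in_itv/= => /andP[xj0 xj1].
  have g0 t : 0 <= t < a -> sector (g t) = 0%N.
    by move=> /ga[]; rewrite /sector => -> ->.
  rewrite /lam; case: ltP => xa; first by rewrite g0// xj0.
  case: ltP => xb.
    have [|h1 h2] := gb (x j); first by rewrite xa.
    by rewrite /sector (ltNge (f1 _)) h1 h2 andbF.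
  case: ltP => x1.
    have [|h1 h2] := gc (x j); first by rewrite xb.
    by rewrite /sector (leNgt _ (f0 _)) (ltNge (f2 _)) h1 h2 andbF.
  have -> : x j = 1 by apply/le_anti; rewrite xj1.
  by rewrite g10 g0// lexx.
suff : W 0%N = 3 by rewrite WN W10.
have rec M : (M <= N)%N -> \sum_(0 <= j < M) turn (L 0%N j) (L 0%N j.+1) =
    (lam (x M))%:Z - (lam (x 0%N))%:Z.
  elim: M => [|M IH] MN; first by rewrite big_geq// subrr.
  rewrite big_nat_recr//= IH; last exact: ltnW.
  rewrite !Llam//; last exact: ltnW.
  have := xS M; have : 0 < N%:R^-1 :> R by rewrite invr_gt0.
  move: (x M.+1) (x M) N%:R^-1 na nba nb1 => u v w wa wba wb1 w0 uv.
  rewrite turn_mod3; first by rewrite addrC addrA subrK.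
    by rewrite /lam; do ![case: ltP => ? //]; exfalso; lra.
  by rewrite /lam; do ![case: ltP => ? //]; exfalso; lra.
by rewrite /W rec// x0 xN /lam a0 !ltNge ltW ?(lt_trans ab)// ltW// lexx.
Unshelve. all: end_near. Qed.
End Winding.

(** * Determinants and closed polygons *)

Section Det3.
Variable R : realType.
Implicit Types (x y z v : 'rV[R]_3) (k : R).

Definition i0 : 'I_3 := @Ordinal 3 0 isT.
Definition i1 : 'I_3 := @Ordinal 3 1 isT.
Definition i2 : 'I_3 := @Ordinal 3 2 isT.

Lemma ord3P (Q : 'I_3 -> Prop) : Q i0 -> Q i1 -> Q i2 -> forall i, Q i.
Proof.
move=> Q0 Q1 Q2 [[|[|[|//]]] ?]; by
  [rewrite (_ : Ordinal _ = i0)//; exact: val_inj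
  |rewrite (_ : Ordinal _ = i1)//; exact: val_inj
  |rewrite (_ : Ordinal _ = i2)//; exact: val_inj].
Qed.

Lemma row3P x y :
  x 0 i0 = y 0 i0 -> x 0 i1 = y 0 i1 -> x 0 i2 = y 0 i2 -> x = y.
Proof. by move=> h0 h1 h2; apply/rowP; apply: ord3P. Qed.

Lemma dotE x y :
  dot x y = x 0 i0 * y 0 i0 + x 0 i1 * y 0 i1 + x 0 i2 * y 0 i2.
Proof.
rewrite /dot !big_ord_recl big_ord0 addr0 addrA.
by congr (_ * _ + _ * _ + _ * _); congr fun_of_matrix; exact: val_inj.
Qed.

Definition det3 v x y : R :=
  v 0 i0 * (x 0 i1 * y 0 i2 - x 0 i2 * y 0 i1)
  - v 0 i1 * (x 0 i0 * y 0 i2 - x 0 i2 * y 0 i0)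
  + v 0 i2 * (x 0 i0 * y 0 i1 - x 0 i1 * y 0 i0).

Lemma det3_cramer v y z x :
  det3 v y z *: x = det3 x y z *: v + det3 v x z *: y + det3 v y x *: z.
Proof. by apply: row3P; rewrite !mxE /det3; ring. Qed.

Lemma det3C v x y : det3 v x y = - det3 v y x.
Proof. by rewrite /det3; ring. Qed.

Lemma det3xx v x : det3 v x x = 0.
Proof. by rewrite /det3; ring. Qed.

Lemma det3_r v x y z k l : det3 v x (k *: y + l *: z) = k * det3 v x y + l * det3 v x z.
Proof. by rewrite /det3 !mxE; ring. Qed.

(** The three-term Plücker relation of plane vectors. It makes the three rescaled forms of [sector]
    sum to 0, and it forbids three forms with positive coefficients from having the same strict
    sign. *)
Lemma det3_plucker v p q r x :
  det3 v q r * det3 v p x + det3 v r p * det3 v q x + det3 v p q * det3 v r x = 0.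
Proof. by rewrite /det3; ring. Qed.

Lemma det3_continuous v x : continuous (det3 v x).
Proof.
have coordC (c : R) (i : 'I_3) : continuous (fun y : 'rV[R]_3 => c * y 0 i).
  by move=> y; exact: (cvgMl_tmp (@coord_continuous R 1 3 0 i y)).
have minorC (a b c : R) (i j : 'I_3) :
    continuous (fun y : 'rV[R]_3 => a * (b * y 0 i - c * y 0 j)).
  by move=> y; exact: (cvgMl_tmp (cvgB (coordC b i y) (coordC c j y))).
by move=> y; exact: (cvgD (cvgB (minorC _ _ _ _ _ y) (minorC _ _ _ _ _ y)) (minorC _ _ _ _ _ y)).
Qed.

Lemma dot_continuous x : continuous (dot x).
Proof.
have -> : dot x = fun y => x 0 i0 * y 0 i0 + x 0 i1 * y 0 i1 + x 0 i2 * y 0 i2.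
  by apply/funext => y; rewrite dotE.
have coordC (c : R) (i : 'I_3) : continuous (fun y : 'rV[R]_3 => c * y 0 i).
  by move=> y; exact: (cvgMl_tmp (@coord_continuous R 1 3 0 i y)).
by move=> y; exact: (cvgD (cvgD (coordC _ _ y) (coordC _ _ y)) (coordC _ _ y)).
Qed.

End Det3.

Section Hat.
Variable R : realType.
Implicit Type x : R.

(* The tent function: 1 - |x| on [-1, 1], and 0 outside. *)
Definition hat x : R := (`|x + 1| + `|x - 1| - `|x| - `|x|) / 2.

Lemma hat_continuous : continuous hat.
Proof.
have nrm (c : R) : continuous (fun x : R => `|x + c|).
  by move=> x; apply: cvg_norm; apply: cvgD; [exact: cvg_id|exact: cvg_cst].
move=> x; apply: cvgMr_tmp.
apply: cvgB; last exact: norm_continuous.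
apply: cvgB; last exact: norm_continuous.
by apply: cvgD; exact: nrm.
Qed.

Lemma hat_fst x : 0 <= x <= 1 -> hat x = 1 - x.
Proof.
move=> /andP[x0 x1]; rewrite /hat (ger0_norm x0) ger0_norm ?addr_ge0//.
by rewrite ler0_norm ?subr_le0//; lra.
Qed.

Lemma hat_snd x : 0 <= x <= 1 -> hat (x - 1) = x.
Proof.
move=> /andP[x0 x1]; rewrite /hat subrK (ger0_norm x0).
by rewrite !ler0_norm ?subr_le0//; lra.
Qed.

Lemma hat_out x : 1 <= `|x| -> hat x = 0.
Proof.
rewrite /hat; case: (lerP 0 x) => x0 x1.
  by move: x1; rewrite (ger0_norm x0) => x1; rewrite !ger0_norm; lra.
move: x1; rewrite (ltr0_norm x0) => x1; rewrite (ler0_norm (_ : x + 1 <= 0)); last by lra.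
by rewrite (ler0_norm (_ : x - 1 <= 0)); lra.
Qed.

End Hat.

Section Polygon.
Variables (R : realType) (V : normedModType R) (n : nat) (y : nat -> V).

(** With tent functions as weights, continuity follows from that of a finite sum and no pieces have
    to be glued; vertex [j] is passed at time [j / n]. *)
Definition polygon (t : R) : V := \sum_(0 <= j < n.+1) hat (n%:R * t - j%:R) *: y j.

Lemma polygon_continuous : continuous polygon.
Proof.
rewrite /polygon; elim: n.+1 n%:R => [|m IH] c.
  have -> : (fun t : R => \sum_(0 <= j < 0) hat (c * t - j%:R) *: y j) = fun=> 0.
    by apply/funext => t; rewrite big_geq.
  by move=> t; exact: cvg_cst.
have -> : (fun t : R => \sum_(0 <= j < m.+1) hat (c * t - j%:R) *: y j) =
    (fun t => \sum_(0 <= j < m) hat (c * t - j%:R) *: y j + hat (c * t - m%:R) *: y m).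
  by apply/funext => t; rewrite big_nat_recr.
move=> t; apply: cvgD; first exact: IH.
apply: cvgZ; last exact: cvg_cst.
apply: (@cvg_comp _ _ _ (fun t => c * t - m%:R) (@hat R)); last exact: hat_continuous.
by apply: cvgB; [apply: cvgMl_tmp; exact: cvg_id|exact: cvg_cst].
Qed.

Lemma polygonE (i : nat) (t u : R) : (i < n)%N -> 0 <= u <= 1 -> n%:R * t = i%:R + u ->
  polygon t = (1 - u) *: y i + u *: y i.+1.
Proof.
move=> iN u01 tE; have /andP[u0 u1] := u01; rewrite /polygon tE.
rewrite (@big_cat_nat _ _ _ i 0%N)//=; last by rewrite ltnW// ltnS ltnW.
rewrite (@big_nat _ _ _ 0%N i) big1 ?add0r; last first.
  move=> j /andP[_ ji]; rewrite hat_out ?scale0r//.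
  have : j%:R + 1 <= i%:R :> R by rewrite -[1](mulr1n) -natrD ler_nat addn1.
  by move=> h; rewrite ger0_norm; lra.
rewrite big_ltn ?ltnS; last exact: ltnW.
rewrite big_ltn ?ltnS// big_nat big1 ?addr0.
  rewrite addrAC subrr add0r hat_fst//; congr (_ + _ *: _).
  by rewrite -natr1 -[RHS]hat_snd//; congr hat; lra.
move=> j /andP[ij _]; rewrite hat_out ?scale0r//.
have : i%:R + 2 <= j%:R :> R by rewrite -[2]/(2%:R) -natrD ler_nat addn2.
by move=> h; rewrite ler0_norm; lra.
Qed.

Lemma polygonP (t : R) : 0 <= t < 1 -> (0 < n)%N -> exists i u,
  [/\ (i < n)%N, 0 <= u < 1, n%:R * t = i%:R + u & polygon t = (1 - u) *: y i + u *: y i.+1].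
Proof.
move=> /andP[t0 t1] n0; have nt0 : 0 <= n%:R * t by rewrite mulr_ge0.
have /andP[h1 h2] := truncn_itv nt0.
exists (Num.trunc (n%:R * t)), (n%:R * t - (Num.trunc (n%:R * t))%:R).
have iN : (Num.trunc (n%:R * t) < n)%N.
  rewrite -(ltr_nat R) (le_lt_trans h1)// -[ltRHS]mulr1 ltr_pM2l// ltr0n//.
split=> //.
- by rewrite subr_ge0 h1 ltrBlDl natr1.
- by rewrite addrC subrK.
apply: polygonE => //; last by rewrite addrC subrK.
by rewrite subr_ge0 h1 lerBlDl natr1 ltW.
Qed.

Lemma polygon0 : (0 < n)%N -> polygon 0 = y 0.
Proof.
move=> n0; rewrite (@polygonE 0 0 0)//.
- by rewrite subr0 scale1r scale0r addr0.
- by rewrite lexx ler01.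
- by rewrite mulr0 addr0.
Qed.
Lemma polygon1 : (0 < n)%N -> polygon 1 = y n.
Proof.
case: n (@polygonE) => // m pE _; rewrite (pE m 1 1) ?subrr ?scale0r ?add0r ?scale1r//.
  by rewrite lexx ler01.
by rewrite mulr1 natr1.
Qed.
End Polygon.

(** * The hole cut by a tube *)

(* Seen along v, the body C lies strictly inside the polygon y, whose vertices are in the
   convex set O; [w] is the planar cross product in that projection. The vertices number
   0, a and b cut the polygon into three arcs on which the labels of [sector] are constant. *)
Section Hole.
Variables (R : realType) (O C : set 'rV[R]_3) (v : 'rV[R]_3).
Variables (n a b : nat) (y : nat -> 'rV[R]_3).
Local Notation w := (det3 v).

Hypothesis O_conv : forall x z t, O x -> O z -> 0 <= t <= 1 ->
  O ((1 - t) *: x + t *: z).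
Hypothesis C_zero : C 0.
Hypothesis C_dir : forall x s, C x -> C (x + s *: v).
Hypothesis C_star : forall x s, C x -> 0 <= s <= 1 -> C (s *: x).
Hypothesis C_inside : forall i x, (i < n)%N -> C x ->
  w x (y i.+1) + w (y i) x < w (y i) (y i.+1).
Hypothesis y_O : forall i, (i <= n)%N -> O (y i).
Hypothesis y_loop : y n = y 0%N.
Hypothesis y_turn : forall i, (i < n)%N -> 0 < w (y i) (y i.+1).
Hypotheses (a_gt0 : (0 < a)%N) (ab : (a < b)%N) (bn : (b < n)%N).
Hypotheses (w_0a : 0 < w (y 0%N) (y a)) (w_ab : 0 < w (y a) (y b))
  (w_b0 : 0 < w (y b) (y 0%N)).
Hypothesis y_arc0 : forall i, (i < a)%N -> 0 <= w (y 0%N) (y i) /\ w (y a) (y i) < 0.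
Hypothesis y_arc1 : forall i, (a <= i < b)%N -> 0 <= w (y a) (y i) /\ w (y b) (y i) < 0.
Hypothesis y_arc2 : forall i, (b <= i < n)%N -> 0 <= w (y b) (y i) /\ w (y 0%N) (y i) < 0.

Let S := O `\` C.
Let n_gt0 : (0 < n)%N. Proof. exact: leq_trans bn. Qed.

(** On the line through [y i] and [y i.+1], the two cross products of [C_inside] add up exactly to
    its right-hand side, whereas [C] requires a strict inequality. *)
Let edge_notC i u : (i < n)%N -> ~ C ((1 - u) *: y i + u *: y i.+1).
Proof.
move=> iN /(C_inside iN); rewrite [w _ (y i.+1)]det3C !det3_r !det3xx [w (y i.+1) _]det3C.
by lra.
Qed.

Let edge_S i u : (i < n)%N -> 0 <= u <= 1 -> S ((1 - u) *: y i + u *: y i.+1).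
Proof.
move=> iN u01; split; last exact: edge_notC.
by apply: O_conv => //; apply: y_O => //; exact: ltnW.
Qed.

Let y_S : S (y 0%N).
Proof.
have -> : y 0%N = (1 - 0) *: y 0%N + 0 *: y 1%N by rewrite subr0 scale1r scale0r addr0.
by apply: edge_S; rewrite // lexx ler01.
Qed.

Let loop := polygon n y.

Let loop10 : loop 1 = loop 0.
Proof. by rewrite /loop polygon1// polygon0. Qed.

Let loop_S t : 0 <= t <= 1 -> S (loop t).
Proof.
move=> /andP[t0]; rewrite le_eqVlt => /orP[/eqP->|t1].
  by rewrite /loop polygon1// y_loop.
rewrite /loop; have [|i [u [iN /andP[u0 u1] _ ->]]] := @polygonP _ _ n y t _ n_gt0.
  by rewrite t0 t1.
by apply: edge_S => //; rewrite u0 ltW.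
Qed.

(** The vectors [y 0] and [y a] are independent modulo [v], so [x] is a multiple of [v]; the axis
    lies in [C] by [C_zero] and [C_dir]. *)
Let line_C x : w (y 0%N) x = 0 -> w (y a) x = 0 -> C x.
Proof.
move=> h0 ha; have := det3_cramer v (y 0%N) (y a) x.
rewrite h0 [w x _]det3C ha oppr0 !scale0r !addr0 => e.
have -> : x = 0 + ((w (y 0%N) (y a))^-1 * det3 x (y 0%N) (y a)) *: v.
  by rewrite add0r -scalerA -e scalerA mulVf ?scale1r// gt_eqF.
exact: C_dir.
Qed.

(** Sign conditions pass from vertices to edges by linearity. At the final vertex [y m] the second
    form may vanish, but [u < 1] leaves a positive weight on [y i], which keeps the inequality
    strict. *)
Let in_arc c m i u x : (forall j, (c <= j < m)%N -> 0 <= w (y c) (y j) /\ w x (y j) < 0) ->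
  0 <= w (y c) (y m) -> w x (y m) <= 0 ->
  (c <= i < m)%N -> 0 <= u < 1 ->
  0 <= w (y c) ((1 - u) *: y i + u *: y i.+1) /\ w x ((1 - u) *: y i + u *: y i.+1) < 0.
Proof.
move=> hj hm hx cim /andP[u0 u1]; have /andP[ci im] := cim.
have [h1 h2] := hj _ cim.
have [h3 h4] : 0 <= w (y c) (y i.+1) /\ w x (y i.+1) <= 0.
  move: im; rewrite leq_eqVlt => /orP[/eqP->//|im].
  have [|? /ltW//] := hj i.+1; by rewrite im ltnW.
have u1' : 0 < 1 - u by rewrite subr_gt0.
rewrite !det3_r; split.
  by rewrite addr_ge0// mulr_ge0// ltW.
by rewrite ltr_wnDr ?mulr_ge0_le0// nmulr_llt0.
Qed.

Lemma hole_not_simply_connected : ~ simply_connected R S.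
Proof.
move=> [_ /(_ loop)].
have loop_path : path_in S loop.
  split; first exact/continuous_subspaceT/polygon_continuous.
  by move=> t; rewrite in_itv/=; exact: loop_S.
move=> /(_ loop_path (esym loop10)).
(* The positive factors are the coefficients of [det3_plucker]; they give sum zero without changing
   any sign. *)
pose f0 x := w (y a) (y b) * w (y 0%N) x.
pose f1 x := w (y b) (y 0%N) * w (y a) x.
pose f2 x := w (y 0%N) (y a) * w (y b) x.
have cf k z : continuous (fun x => k * w z x).
  by move=> x; exact: (cvgMl_tmp (@det3_continuous R v z x)).
have nR : 0 < n%:R :> R by rewrite ltr0n.
have div_lt c (t : R) : t < c%:R / n%:R -> n%:R * t < c%:R.
  by rewrite ltr_pdivlMr// mulrC.
have le_div c (t : R) : c%:R / n%:R <= t -> c%:R <= n%:R * t.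
  by rewrite ler_pdivrMr// mulrC.
have locate c m (t : R) : (m <= n)%N -> c%:R / n%:R <= t < m%:R / n%:R ->
    exists i u, [/\ (c <= i < m)%N, 0 <= u < 1 &
      loop t = (1 - u) *: y i + u *: y i.+1].
  move=> mn /andP[ct tm].
  have t0 : 0 <= t by rewrite (le_trans _ ct)// divr_ge0.
  have t1 : t < 1 by rewrite (lt_le_trans tm)// ler_pdivrMr// mul1r ler_nat.
  rewrite /loop; have [|i [u [iN u01 e ->]]] := @polygonP _ _ n y t _ n_gt0; first by rewrite t0 t1.
  exists i, u; split=> //; have /andP[u0 u1] := u01.
  rewrite -ltnS -!(ltr_nat R); apply/andP; split.
    by rewrite -natr1; have := le_div _ _ ct; lra.
  by have := div_lt _ _ tm; lra.
apply: (@winding_not_null R _ S f0 f1 f2 _ _ _ _ loop (a%:R / n%:R) (b%:R / n%:R)).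
- exact: cf.
- exact: cf.
- by move=> x; exact: det3_plucker.
- move=> x [_ Cx] [/eqP h0 /eqP h1 _]; apply: Cx; apply: line_C.
    by move: h0; rewrite mulf_eq0 gt_eqF//= => /eqP.
  by move: h1; rewrite mulf_eq0 gt_eqF//= => /eqP.
- by rewrite divr_gt0// ltr0n.
- by rewrite ltr_pM2r ?invr_gt0// ltr_nat.
- by rewrite ltr_pdivrMr// mul1r ltr_nat.
- exact: loop10.
- move=> t t0a; have [||i [u [ia u01 ->]]] := locate 0%N a t.
  + by rewrite ltnW// (ltn_trans ab).
  + by rewrite mul0r.
  rewrite /f0 /f1 pmulr_rge0// pmulr_rlt0//.
  by apply: (in_arc (m := a)) => //; rewrite ?det3xx// ltW.
- move=> t tab; have [||i [u [iab u01 ->]]] := locate a b t => //.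
    exact: ltnW.
  rewrite /f1 /f2 pmulr_rge0// pmulr_rlt0//.
  by apply: (in_arc (m := b)) => //; rewrite ?det3xx// ltW.
- move=> t tb1; have [||i [u [ib u01 ->]]] := locate b n t => //.
    by rewrite divff// gt_eqF.
  rewrite /f2 /f0 pmulr_rge0// pmulr_rlt0//.
  by apply: (in_arc (m := n)) => //; rewrite ?y_loop ?det3xx// ltW.
Qed.

(** Otherwise [0 <= w (y i) x] would force [0 < w (y i.+1) x] at every edge. Around the loop all
    [w (y i) x] would be positive or, going backwards from [y n], all negative; at the indices 0,
    [a] and [b] this contradicts [det3_plucker], whose coefficients are positive here. *)
Let crossing x : exists2 i, (i < n)%N & 0 <= w (y i) x /\ 0 <= w x (y i.+1).
Proof.
apply: contrapT => none.
have step i : (i < n)%N -> 0 <= w (y i) x -> 0 < w (y i.+1) x.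
  move=> iN h; rewrite ltNge; apply/negP => h'; apply: none; exists i => //.
  by split=> //; rewrite det3C oppr_ge0.
have bp := det3_plucker v (y 0%N) (y a) (y b) x.
have [h0|h0] := leP 0 (w (y 0%N) x).
  have pos i : (i <= n)%N -> (0 < i)%N -> 0 < w (y i) x.
    elim: i => // i IH iN _; apply: step => //; case: i IH iN => // i IH iN.
    by apply/ltW/IH => //; exact: ltnW.
  have p0 : 0 < w (y 0%N) x by rewrite -y_loop pos.
  have pa : 0 < w (y a) x by rewrite pos// ltnW// (ltn_trans ab).
  have pb : 0 < w (y b) x by rewrite pos ?(ltn_trans a_gt0)// ltnW.
  suff : 0 < 0 :> R by rewrite ltxx.
  by rewrite -[X in _ < X]bp !addr_gt0// mulr_gt0.
have neg i : (i <= n)%N -> w (y (n - i)%N) x < 0.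
  elim: i => [|i IH] iN; first by rewrite subn0 y_loop.
  rewrite ltNge; apply/negP => /step; rewrite -subSn// subSS.
  move=> /(_ (leq_subr _ _)) => h; have := IH (ltnW iN).
  by rewrite ltNge ltW// h// -subSS subSn//  leq_subLR -addSnnS leq_addl.
have na : w (y a) x < 0.
  by rewrite -(subKn (_ : a <= n)%N) ?neg ?leq_subr// ltnW// (ltn_trans ab).
have nb : w (y b) x < 0 by rewrite -(subKn (_ : b <= n)%N) ?neg ?leq_subr// ltnW.
suff : 0 < 0 :> R by rewrite ltxx.
by rewrite -[X in X < _]bp; rewrite !ltr_wnDr ?nmulr_llt0//; rewrite ltW// nmulr_llt0.
Qed.

Let segment_path (x z : 'rV[R]_3) (t : R) := (1 - t) *: x + t *: z.

Let segment_image_connected x z : connected (segment_path x z @` `[0, 1]).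
Proof.
apply: connected_continuous_connected; first exact: segment_connected.
apply: continuous_subspaceT => t; apply: cvgD.
  by apply: cvgZr_tmp; apply: cvgB; [exact: cvg_cst|exact: cvg_id].
by apply: cvgZr_tmp; exact: cvg_id.
Qed.

(* A point of O outside of C is joined to the polygon along the ray that its projection
   spans: C is star-shaped, so it cannot meet the part of the ray beyond either end. *)
Lemma hole_connected : connected S.
Proof.
pose G := loop @` `[0, 1].
have cG : connected G.
  apply: connected_continuous_connected; first exact: segment_connected.
  exact/continuous_subspaceT/polygon_continuous.
have G0 : G (y 0%N) by exists 0; [rewrite /= in_itv/= lexx ler01|rewrite /loop polygon0].
have GS : G `<=` S by move=> _ [t /= t01 <-]; apply: loop_S; rewrite in_itv in t01.
have reach x : S x -> exists2 q, G q & segment_path x q @` `[0, 1] `<=` S.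
  move=> [Ox Cx]; have [i iN [be al]] := crossing x.
  pose D := w (y i) (y i.+1); pose A := w x (y i.+1); pose B := w (y i) x.
  rewrite -/A in al; rewrite -/B in be.
  have D0 : 0 < D by exact: y_turn.
  have Dn0 := lt0r_neq0 D0.
  have AB0 : 0 < A + B.
    (* If [A] and [B] both vanish, [x] lies on the axis, hence in [C]. *)
    rewrite lt_neqAle addr_ge0// andbT eq_sym; apply/eqP => AB0; apply: Cx.
    have A0 : A = 0 by apply/eqP; rewrite eq_le al andbT -AB0 lerDl.
    have B0 : B = 0 by move: AB0; rewrite A0 add0r.
    have -> : x = 0 + (D^-1 * det3 x (y i) (y i.+1)) *: v.
      rewrite add0r -scalerA -[LHS]scale1r -(mulVf Dn0) -scalerA; congr (_ *: _).
      by rewrite det3_cramer -/A -/B A0 B0 !scale0r !addr0.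
    exact: C_dir.
  (* By Cramer's rule [D x] is [A y_i + B y_(i+1)] modulo [v]; dividing by [A + B] gives the point
     where the ray of [x] meets the edge. *)
  pose q := (1 - B / (A + B)) *: y i + (B / (A + B)) *: y i.+1.
  have u01 : 0 <= B / (A + B) <= 1.
    by rewrite divr_ge0// ?(ltW AB0)//= ler_pdivrMr// mul1r lerDr.
  exists q.
    exists ((i%:R + B / (A + B)) / n%:R).
      have nR : 0 < n%:R :> R by rewrite ltr0n.
      have /andP[u0 u1] := u01.
      rewrite /= in_itv/= divr_ge0 ?addr_ge0//= ler_pdivrMr// mul1r.
      by rewrite (le_trans (lerD (lexx _) u1))// natr1 ler_nat.
    apply: polygonE => //; rewrite mulrC divfK// gt_eqF// ltr0n//.
  pose s := (A + B) / D; pose c := D^-1 * det3 x (y i) (y i.+1).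
  have xE : x = s *: q + c *: v.
    rewrite -[LHS]scale1r -(mulVf Dn0) -scalerA det3_cramer -/A -/B.
    apply: row3P; rewrite !mxE /s /c; field; rewrite !gt_eqF//.
  have Cq : ~ C q by exact: edge_notC.
  have Oq : O q by apply: O_conv => //; apply: y_O => //; exact: ltnW.
  move=> z [t /=]; rewrite in_itv/= => t01 <-; split; first exact: O_conv.
  have /andP[t0 t1] := t01.
  pose m := (1 - t) * s + t.
  have -> : segment_path x q t = m *: q + ((1 - t) * c) *: v.
    by rewrite /segment_path {1}xE; apply: row3P; rewrite !mxE /m; ring.
  move=> /(C_dir (- ((1 - t) * c))); rewrite scaleNr addrK => Cm.
  have s0 : 0 < s by rewrite divr_gt0.
  (* The parameter [m] lies between [s] and 1. A point of [C] on the segment would shrink to [q]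
     when [s >= 1], and to [x] when [s <= 1]. *)
  have [s1|/ltW s1] := leP 1 s.
    have m1 : 1 <= m by rewrite /m; nra.
    apply: Cq; rewrite -[q]scale1r -(mulVf (_ : m != 0)); last first.
      by rewrite gt_eqF// (lt_le_trans ltr01).
    rewrite -scalerA; apply: C_star => //.
    by rewrite invr_ge0 (le_trans ler01 m1) invf_le1// (lt_le_trans ltr01).
  have sm : s <= m by rewrite /m; nra.
  have m0 : 0 < m by exact: lt_le_trans sm.
  apply: Cx; rewrite xE; apply: C_dir.
  rewrite -[s](divfK (_ : m != 0)) ?gt_eqF// -scalerA; apply: C_star => //.
  by rewrite divr_ge0 ?(ltW s0) ?(ltW m0)// ler_pdivrMr// mul1r.
have /choice[q qP] : forall x, exists z, S x ->
    G z /\ segment_path x z @` `[0, 1] `<=` S.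
  move=> x; have [Sx|nSx] := pselect (S x); last by exists 0.
  by have [z ? ?] := reach x Sx; exists z.
pose F x := G `|` segment_path x (q x) @` `[0, 1].
have -> : S = \bigcup_(x in S) F x.
  apply/seteqP; split => x.
    move=> Sx; exists x => //; right; exists 0; first by rewrite /= in_itv/= lexx ler01.
    by rewrite /segment_path subr0 scale1r scale0r addr0.
  by move=> [z Sz [/GS//|]]; have [_] := qP _ Sz; apply.
apply: bigcup_connected; first by exists (y 0%N) => x _; left.
move=> x Sx; apply: connectedU => //; exists (q x); split; first by have [] := qP _ Sx.
exists 1; first by rewrite /= in_itv/= lexx ler01.
by rewrite /segment_path subrr scale0r scale1r add0r.
Qed.

End Hole.

(** * Polytopes as polar duals *)

Section Dot.
Variable R : realType.
Implicit Types (x y z : 'rV[R]_3) (k : R).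

Lemma dotC x y : dot x y = dot y x.
Proof. by rewrite !dotE; ring. Qed.
Lemma dotDr x y z : dot x (y + z) = dot x y + dot x z.
Proof. by rewrite !dotE !mxE; ring. Qed.
Lemma dotZr x k y : dot x (k *: y) = k * dot x y.
Proof. by rewrite !dotE !mxE; ring. Qed.
Lemma dotNr x y : dot x (- y) = - dot x y.
Proof. by rewrite !dotE !mxE; ring. Qed.
Lemma dotZl x k y : dot (k *: x) y = k * dot x y.
Proof. by rewrite dotC dotZr dotC. Qed.
Lemma dotNl x y : dot (- x) y = - dot x y.
Proof. by rewrite dotC dotNr dotC. Qed.
Lemma dot0r x : dot x 0 = 0.
Proof. by rewrite !dotE !mxE; ring. Qed.

Lemma dotxx_eq0 x : dot x x = 0 -> x = 0.
Proof.
have h (u : R) : 0 <= u * u by rewrite -expr2 sqr_ge0.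
rewrite dotE => e; have := (h (x 0 i0), h (x 0 i1), h (x 0 i2)) => -[[h0 h1] h2].
by apply: row3P; rewrite mxE; apply/eqP; rewrite -[_ == 0]orbb -mulf_eq0; apply/eqP; lra.
Qed.

End Dot.

Section Hull.
Variable R : realType.
Implicit Types (A B : set 'rV[R]_3) (x y : 'rV[R]_3).

Lemma convex_setP B : @convex_set R _ B <->
  forall x y (t : R), B x -> B y -> 0 <= t <= 1 -> B (t *: x + (1 - t) *: y).
Proof.
split=> [cB x y t Bx By /andP[t0 t1]|cB x y l].
  by have := cB x y (Itv01 t0 t1); rewrite !inE; apply.
by rewrite !inE => Bx By; apply: cB => //; apply/andP; split.
Qed.

Lemma hull_convex A x y (t : R) : convex_hull A x -> convex_hull A y -> 0 <= t <= 1 ->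
  convex_hull A (t *: x + (1 - t) *: y).
Proof.
move=> hx hy t01 B [cB AB]; apply: (convex_setP B).1 => //.
  by apply: hx.
by apply: hy.
Qed.

Lemma hull_min A B : (forall x y (t : R), B x -> B y -> 0 <= t <= 1 ->
  B (t *: x + (1 - t) *: y)) -> A `<=` B -> convex_hull A `<=` B.
Proof. by move=> cB AB x; apply; split => //; apply/convex_setP. Qed.

Lemma sub_hull A : A `<=` convex_hull A.
Proof. by move=> x Ax B [_]; apply. Qed.

End Hull.

Lemma seq_argmin (R : realType) (T : eqType) (P : pred T) (f : T -> R) (s : seq T) :
  has P s -> exists2 x0, (x0 \in s) && P x0 & forall x, x \in s -> P x -> f x0 <= f x.
Proof.
elim: s => //= z s IH; case: (boolP (has P s)) => [/IH[x0 /andP[x0s Px0] x0P] _|].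
  have [Pz|Pz] := boolP (P z); last first.
    exists x0; rewrite ?inE ?x0s ?orbT// => x; rewrite inE => /orP[/eqP->|]; last exact: x0P.
    by rewrite (negPf Pz).
  have [fz|fz] := leP (f z) (f x0).
    exists z; rewrite ?inE ?eqxx// => x; rewrite inE => /orP[/eqP->//|xs Px].
    by apply: (le_trans fz); exact: x0P.
  exists x0; rewrite ?inE ?x0s ?orbT// => x; rewrite inE => /orP[/eqP-> _|]; last exact: x0P.
  exact: ltW.
move=> /hasPn nP; rewrite orbF => Pz; exists z; rewrite ?inE ?eqxx// => x.
by rewrite inE => /orP[/eqP->//|/nP/negPf->].
Qed.

Lemma count_lt (T : eqType) (P Q : pred T) (s : seq T) (x0 : T) :
  x0 \in s -> {in s, forall x, P x -> Q x} -> Q x0 -> ~~ P x0 -> (count P s < count Q s)%N.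
Proof.
move=> x0s PQ Qx Px.
have /perm_to_rem e := x0s; rewrite !(seq.permP e) /= Qx (negPf Px) add0n add1n ltnS.
rewrite -!size_filter -(@eq_in_filter _ (fun x => P x && Q x) P) ?size_filter.
  by apply: sub_count => x /andP[].
by move=> x /mem_rem /PQ; case: (P x) => //= ->.
Qed.

Section Polytope.
Variables (R : realType) (s : seq 'rV[R]_3).
Hypothesis s_bounded : forall d, (forall x, x \in s -> dot x d <= 0) -> d = 0.
Implicit Types x y z d : 'rV[R]_3.

Local Notation K := (polar_dual [set` s]).
Local Notation V := (vertices K).
Let tight y : pred 'rV[R]_3 := fun x => dot x y == 1.

Lemma polar_convex x y (t : R) : K x -> K y -> 0 <= t <= 1 -> K (t *: x + (1 - t) *: y).
Proof.
move=> Kx Ky /andP[t0 t1] z zs; rewrite dotDr !dotZr.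
by have := Kx z zs; have := Ky z zs; nra.
Qed.

(* Moving along d until the first constraint becomes tight. *)
Lemma polar_push y d : K y -> d != 0 -> (forall x, x \in s -> dot x y = 1 -> dot x d = 0) ->
  exists r : R, [/\ 0 < r, K (y + r *: d) & (count (tight y) s < count (tight (y + r *: d)) s)%N].
Proof.
move=> Ky dn0 td.
have : has (fun x => 0 < dot x d) s.
  apply: contraNT dn0 => /hasPn h; apply/eqP; apply: s_bounded => x /h.
  by rewrite -leNgt.
move=> /(seq_argmin (fun x => (1 - dot x y) / dot x d))[x0 /andP[x0s x0d] x0P].
have y1 : dot x0 y < 1.
  rewrite lt_neqAle Ky// andbT; apply/eqP => /(td _ x0s) h.
  by move: x0d; rewrite h ltxx.
exists ((1 - dot x0 y) / dot x0 d); split.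
- by rewrite divr_gt0// subr_gt0.
- move=> x xs; rewrite dotDr dotZr; have Kx := Ky _ xs.
  have [xd|xd] := leP (dot x d) 0.
    have : 0 < (1 - dot x0 y) / dot x0 d by rewrite divr_gt0// subr_gt0.
    by nra.
  have := x0P x xs xd; rewrite ler_pdivlMr//.
  by lra.
- apply: (count_lt x0s).
  + move=> x xs /eqP xy; apply/eqP; rewrite dotDr dotZr xy (td x)// mulr0 addr0//.
  + by rewrite /tight /= dotDr dotZr divfK ?lt0r_neq0// addrC subrK.
  + by rewrite /tight /= lt_eqF.
Qed.

(** Minkowski's theorem, by induction on the number of constraints that are not tight. A point that
    is not extreme lies inside a segment of [K]; pushing it both ways along the segment makes more
    constraints tight, and it is a convex combination of the two results. *)
Lemma polar_hull : convex_hull V = K.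
Proof.
apply/seteqP; split; first by apply: hull_min; [exact: polar_convex|move=> x []].
suff rec m y : K y -> (size s < count (tight y) s + m)%N -> convex_hull V y.
  by move=> y Ky; apply: (rec (size s).+1 y Ky); rewrite addnS ltnS leq_addl.
elim: m y => [y _|m IH y Ky ym]; first by rewrite addn0 ltnNge count_size.
have [Vy|nVy] := pselect (V y); first exact: sub_hull.
have [a [b [t [Ka Kb t01 yE ab]]]] : exists a b (t : R),
    [/\ K a, K b, 0 < t < 1, y = t *: a + (1 - t) *: b & a != b].
  apply: contrapT => h; apply: nVy; split => // a b t Ka Kb t01 yE.
  by apply: contrapT => /eqP ab; apply: h; exists a, b, t.
have /andP[t0 t1] := t01.
(* A constraint tight at a point strictly between [a] and [b] is tight at both, hence constant along
   [a - b]. *)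
have td x : x \in s -> dot x y = 1 -> dot x (a - b) = 0.
  move=> xs; rewrite yE !dotDr dotNr !dotZr; have := Ka _ xs; have := Kb _ xs.
  by nra.
have step d : d != 0 -> (forall x, x \in s -> dot x y = 1 -> dot x d = 0) ->
    exists2 r : R, 0 < r & convex_hull V (y + r *: d).
  move=> dn0 {}td; have [r [r0 Kr c]] := polar_push Ky dn0 td.
  by exists r => //; apply: IH => //; move: ym c; lia.
have abn : a - b != 0 by rewrite subr_eq0.
have [r1 r10 h1] := step _ abn td.
have [||r2 r20 h2] := step (- (a - b)).
- by rewrite oppr_eq0.
- by move=> x xs xy; rewrite dotNr td// oppr0.
have -> : y = (r2 / (r1 + r2)) *: (y + r1 *: (a - b)) +
    (1 - r2 / (r1 + r2)) *: (y + r2 *: - (a - b)).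
  have : r1 + r2 != 0 by rewrite gt_eqF// addr_gt0.
  by move=> ?; apply: row3P; rewrite !mxE; field.
apply: hull_convex => //; have r12 : 0 < r1 + r2 by rewrite addr_gt0.
by rewrite divr_ge0 ?(ltW r20) ?(ltW r12)//= ler_pdivrMr// mul1r lerDr ltW.
Qed.

(** If [y] and [z] differed, [polar_push] would extend the segment from [z] beyond [y] within [K],
    and [y] would not be extreme. Vertices are thus determined by their tight sets, hence finite in
    number. *)
Lemma vertices_eq_tight y z : V y -> V z -> {in s, tight y =1 tight z} -> y = z.
Proof.
move=> [Ky yV] [Kz zV] yz; apply/eqP; apply/negPn/negP => nyz.
have [||r [r0 Kr _]] := @polar_push y (y - z) Ky.
- by rewrite subr_eq0.
- move=> x xs xy; rewrite dotDr dotNr xy; move: (yz x xs); rewrite /tight /= xy eqxx.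
  by move/esym/eqP ->; rewrite subrr.
have r1 : 0 < 1 + r by rewrite addr_gt0.
have := yV _ _ (r / (1 + r)) Kz Kr; rewrite divr_gt0//= ltr_pdivrMr// mul1r ltrDr ltr01.
have r1n : 1 + r != 0 by rewrite gt_eqF.
move=> /(_ isT) h; apply/negP: nyz; rewrite negbK -subr_eq0.
have -> : y - z = (1 + r)^-1 *: (y + r *: (y - z) - z).
  by apply: row3P; rewrite !mxE; field.
rewrite -h ?subrr ?scaler0//.
by apply: row3P; rewrite !mxE; field.
Qed.

Lemma vertices_finite : finite_set V.
Proof.
pose mask y : {ffun 'I_(size s) -> bool} := [ffun i : 'I_(size s) => tight y (s`_i)].
pose pt m := xget 0 [set y | V y /\ mask y = m].
apply: (sub_finite_set (B := pt @` setT)); last exact: finite_image.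
move=> y Vy; exists (mask y) => //.
rewrite /pt; case: xgetP => [z _ [Vz zy]|/(_ y)]; last by case.
apply: vertices_eq_tight => // x /(nthP 0)[i il <-].
by have /ffunP/(_ (Ordinal il)) := zy; rewrite !ffunE.
Qed.

Lemma interior_polar : K° = [set y | forall x, x \in s -> dot x y < 1].
Proof.
apply/seteqP; split => y.
  move=> nK x xs; have Ky := interior_subset nK.
  (* A slight dilation of an interior point stays in [K], but would violate a tight constraint. *)
  have : \forall t \near (1 : R), K (t *: y).
    have : (fun t : R => t *: y) t @[t --> (1 : R)] --> y.
      by rewrite -[X in _ --> X]scale1r; apply: cvgZr_tmp; exact: cvg_id.
    exact.
  move=> /nbhs_ballP[e /= e0 eP].
  have : K ((1 + e / 2) *: y).
    apply: eP; rewrite /ball /= opprD addrA subrr sub0r normrN gtr0_norm ?divr_gt0//.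
    by rewrite gtr_pMr// invf_lt1// ltr1n.
  by move=> /(_ x xs); rewrite dotZr; have := Ky x xs; nra.
move=> yK; suff : \forall z \near y, all (fun x => dot x z < 1) s.
  by apply: filterS => z /allP zK x /zK/ltW.
have {yK} : all (fun x => dot x y < 1) s by apply/allP.
elim: (s) => [_|x l IH /= /andP[xy ly]]; first by exact: filterE.
near=> z; apply/andP; split; near: z; last exact: IH.
exact: (cvgr_lt _ (@dot_continuous _ x y)).
Unshelve. all: end_near. Qed.

(** A plane containing the vertices contains their hull [K]. As 0 is interior to [K], the plane
    passes through 0 and contains a small positive multiple of its normal [n]. *)
Lemma vertices_nondegenerate n c : (forall p, V p -> dot n p = c) -> n = 0.
Proof.
move=> Vc; have Kc : K `<=` [set y | dot n y = c].
  rewrite -polar_hull; apply: hull_min => // x y t /= xc yc _.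
  by rewrite dotDr !dotZr xc yc; ring.
have K0 : K° 0 by rewrite interior_polar => x _; rewrite dot0r.
have : \forall t \near (0 : R), K (t *: n).
  have : (fun t : R => t *: n) t @[t --> (0 : R)] --> (0 : 'rV[R]_3).
    by rewrite -[X in _ --> X](scale0r n); apply: cvgZr_tmp; exact: cvg_id.
  exact.
move=> /nbhs_ballP[e /= e0 eP].
have c0 : c = 0 by rewrite -(Kc _ (interior_subset K0)) dot0r.
have /Kc /= : K ((e / 2) *: n).
  apply: eP; rewrite /ball /= sub0r normrN gtr0_norm ?divr_gt0//.
  by rewrite gtr_pMr// invf_lt1// ltr1n.
rewrite dotZr c0 => /eqP; rewrite mulf_eq0 gt_eqF ?divr_gt0//= => /eqP.
exact: dotxx_eq0.
Qed.

End Polytope.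

(** * Similarities *)

Section Homeomorphism.
Variables (R : realType) (T : topologicalType) (f g : T -> T).
Hypotheses (cf : continuous f) (cg : continuous g).
Hypotheses (fK : cancel f g) (gK : cancel g f).

Lemma interior_image (A : set T) : (f @` A)° = f @` A°.
Proof.
apply/seteqP; split => y.
  move=> Ay; exists (g y); last by rewrite gK.
  have : nbhs (g y) (f @^-1` (f @` A)) by apply: cf; rewrite gK.
  by apply: filterS => x [z Az /(can_inj fK) <-].
move=> [x Ax <-]; have : nbhs (f x) (g @^-1` A) by apply: cg; rewrite fK.
by apply: filterS => z Az; exists (g z) => //; rewrite gK.
Qed.

Lemma simply_connected_image (A : set T) :
  simply_connected R (f @` A) -> simply_connected R A.
Proof.
have gA x : (f @` A) x -> A (g x) by move=> [z Az <-]; rewrite fK.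
move=> [pc nh]; split.
  move=> x y Ax Ay; have [||h [[ch hA] h0 h1]] := pc (f x) (f y); try by [exists x|exists y].
  exists (g \o h); split; rewrite /= ?h0 ?h1 ?fK//; split.
    move=> t; apply: cvg_comp; [exact: ch|exact: cg].
  by move=> t t01; apply/gA/hA.
move=> h [ch hA] h01.
have [|| H [cH HA H0 H1]] := nh (f \o h).
- split; first by move=> t; apply: cvg_comp; [exact: ch|exact: cf].
  by move=> t t01; exists (h t) => //; exact: hA.
- by rewrite /= h01.
exists (g \o H); split.
- by move=> t; apply: cvg_comp; [exact: cH|exact: cg].
- by move=> s t s01 t01; apply/gA/HA.
- by move=> t /H0 /= [-> ->]; rewrite !fK.
- by move=> t /H1 /= [-> ->]; rewrite !fK.
Qed.

End Homeomorphism.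

Lemma has_hole_image (R : realType) (f g : 'rV[R]_3 -> 'rV[R]_3) A :
  continuous f -> continuous g -> cancel f g -> cancel g f ->
  has_hole A -> has_hole (f @` A).
Proof.
move=> cf cg fK gK [cA nA]; rewrite /has_hole (interior_image cf cg fK gK); split.
  by apply: connected_continuous_connected => //; exact: continuous_subspaceT.
by move=> /(simply_connected_image cf cg fK) /nA.
Qed.

Lemma mulmxr_continuous (R : realType) (M : 'M[R]_3) :
  continuous (fun x : 'rV[R]_3 => x *m M).
Proof.
have -> : (fun x : 'rV[R]_3 => x *m M) = fun x =>
    x 0 i0 *: row i0 M + x 0 i1 *: row i1 M + x 0 i2 *: row i2 M.
  apply/funext => x; rewrite mulmx_sum_row !big_ord_recl big_ord0 addr0 addrA.
  by congr (_ *: _ + _ *: _ + _ *: _); do ?congr fun_of_matrix; do ?congr row; exact: val_inj.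
have rowC (i : 'I_3) : continuous (fun x : 'rV[R]_3 => x 0 i *: row i M).
  by move=> x; exact: (cvgZr_tmp (@coord_continuous R 1 3 0 i x)).
by move=> x; exact: (cvgD (cvgD (rowC _ x) (rowC _ x)) (rowC _ x)).
Qed.

Section Affine.
Variable R : realType.
Implicit Types (A : set 'rV[R]_3) (x y : 'rV[R]_3).

Lemma hull_image (f : 'rV[R]_3 -> 'rV[R]_3) A :
  (forall x y (t : R), f (t *: x + (1 - t) *: y) = t *: f x + (1 - t) *: f y) ->
  convex_hull (f @` A) = f @` convex_hull A.
Proof.
move=> fA; apply/seteqP; split.
  apply: hull_min; last by move=> _ [x Ax <-]; exists x => //; exact: sub_hull.
  move=> _ _ t [x hx <-] [y hy <-] t01; exists (t *: x + (1 - t) *: y) => //.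
  exact: hull_convex.
have : convex_hull A `<=` f @^-1` convex_hull (f @` A).
  apply: hull_min; last by move=> x Ax; apply: sub_hull; exists x.
  by move=> x y t hx hy t01; rewrite /preimage /= fA; exact: hull_convex.
by move=> h _ [x /h ? <-].
Qed.

Lemma dot_mulmx x y (M : 'M[R]_3) : dot x (y *m M) = dot (x *m M^T) y.
Proof.
have dotM u w : dot u w = (u *m w^T) 0 0.
  by rewrite mxE; apply: eq_bigr => i _; rewrite mxE.
by rewrite !dotM trmx_mul mulmxA.
Qed.

Variables (k : R) (M : 'M[R]_3) (t : 'rV[R]_3).
Hypotheses (k_gt0 : 0 < k) (M_orth : M *m M^T = 1%:M).

Definition sim x := k *: (x *m M) + t.
Definition sim_inv x := k^-1 *: ((x - t) *m M^T).

Let kn0 : k != 0. Proof. exact: lt0r_neq0. Qed.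

Lemma simK : cancel sim sim_inv.
Proof.
move=> x; rewrite /sim /sim_inv addrK -scalemxAl scalerA mulVf// scale1r.
by rewrite -mulmxA M_orth mulmx1.
Qed.

Lemma sim_invK : cancel sim_inv sim.
Proof.
move=> x; rewrite /sim /sim_inv -scalemxAl scalerA divff// scale1r.
by rewrite -mulmxA (mulmx1C M_orth) mulmx1 subrK.
Qed.

Lemma sim_continuous : continuous sim.
Proof.
by move=> x; exact: (cvgD (cvgZl_tmp (@mulmxr_continuous _ M x)) (cvg_cst t)).
Qed.

Lemma sim_inv_continuous : continuous sim_inv.
Proof.
have subC : continuous (fun x : 'rV[R]_3 => x - t).
  by move=> x; exact: (cvgB (@cvg_id _ (nbhs x)) (@cvg_cst _ t _ (nbhs x) _)).
have compC : continuous (fun x : 'rV[R]_3 => (x - t) *m M^T).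
  by move=> x; apply: (@continuous_comp _ _ _ (fun x => x - t) (fun z => z *m M^T));
    [exact: subC|exact: mulmxr_continuous].
by move=> x; exact: (cvgZl_tmp (compC x)).
Qed.

Lemma sim_affine x y (r : R) : sim (r *: x + (1 - r) *: y) = r *: sim x + (1 - r) *: sim y.
Proof.
rewrite /sim mulmxDl -!scalemxAl; move: (x *m M) (y *m M) => a b.
by apply: row3P; rewrite !mxE; ring.
Qed.

Lemma polyhedron_sim (s : seq 'rV[R]_3) :
  (forall d, (forall x, x \in s -> dot x d <= 0) -> d = 0) ->
  polyhedron (sim @` vertices (polar_dual [set` s])).
Proof.
move=> s_bd; set K := polar_dual _; set V := vertices K; split.
- exact/finite_image/vertices_finite.
- move=> _ [x Vx <-]; have -> : (sim @` V) `\ sim x = sim @` (V `\ x).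
    apply/seteqP; split=> [_ [[y Vy <-] yx]|_ [y [Vy yx] <-]].
      by exists y => //; split => // yx'; apply: yx; rewrite yx'.
    by split; [exists y|move=> /(can_inj simK)].
  rewrite (hull_image _ sim_affine) => -[y hy /(can_inj simK) yx].
  (* Removing an extreme point leaves a convex set; it contains the other vertices, hence their
     hull. *)
  suff : (K `\ x) y by case.
  apply: hull_min hy; last by move=> z [[Kz _] zx].
  move=> a b r [Ka ax] [Kb bx] r01; split; first exact: polar_convex.
  have /andP[r0 r1] := r01; move=> e; have [Kx xV] := Vx.
  have [r00|rn0] := eqVneq r 0.
    by apply: bx; rewrite /= -e r00 scale0r add0r subr0 scale1r.
  have [r11|rn1] := eqVneq r 1.
    by apply: ax; rewrite /= -e r11 subrr scale1r scale0r addr0.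
  have := xV a b r Ka Kb.
  rewrite !lt_neqAle r0 r1 rn1 [0 == r]eq_sym rn0 => /(_ isT (esym e)) ab.
  by apply: ax; rewrite /= -e ab -scalerDl addrC subrK scale1r.
- move=> [n [c nn0 nc]]; move/eqP: nn0; apply.
  suff : n *m M^T = 0 by move=> h; rewrite -[n]mulmx1 -(mulmx1C M_orth) mulmxA h mul0mx.
  apply: (vertices_nondegenerate s_bd (c := (c - dot n t) / k)) => p Vp.
  have := nc (sim p); rewrite /sim dotDr dotZr dot_mulmx => <-; last by exists p.
  by rewrite addrK mulrC mulKf.
Qed.

End Affine.

Section DualRupert.
Variables (R : realType) (s : seq 'rV[R]_3) (N : 'M[R]_3) (v : 'rV[R]_3).
Variables (n a b : nat) (y : nat -> 'rV[R]_3).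
Local Notation w := (det3 v).
Local Notation K := (polar_dual [set` s]).

Hypothesis s_bounded : forall d, (forall x, x \in s -> dot x d <= 0) -> d = 0.
Hypothesis N_orth : N *m N^T = 1%:M.
Hypothesis shadow : forall i, (i < n)%N -> exists2 c : R, c < w (y i) (y i.+1) &
  forall x, K x -> w (x *m N) (y i.+1) + w (y i) (x *m N) <= c.
Hypothesis y_inside : forall i, (i <= n)%N -> forall x, x \in s -> dot x (y i) < 1.
Hypothesis y_loop : y n = y 0%N.
Hypothesis y_turn : forall i, (i < n)%N -> 0 < w (y i) (y i.+1).
Hypotheses (a_gt0 : (0 < a)%N) (ab : (a < b)%N) (bn : (b < n)%N).
Hypotheses (w_0a : 0 < w (y 0%N) (y a)) (w_ab : 0 < w (y a) (y b))
  (w_b0 : 0 < w (y b) (y 0%N)).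
Hypothesis y_arc0 : forall i, (i < a)%N -> 0 <= w (y 0%N) (y i) /\ w (y a) (y i) < 0.
Hypothesis y_arc1 : forall i, (a <= i < b)%N -> 0 <= w (y a) (y i) /\ w (y b) (y i) < 0.
Hypothesis y_arc2 : forall i, (b <= i < n)%N -> 0 <= w (y b) (y i) /\ w (y 0%N) (y i) < 0.

Let T : set 'rV[R]_3 := [set x | exists z, exists2 r : R, K z & x = z *m N + r *: v].

Let closure_stable (f : 'rV[R]_3 -> 'rV[R]_3) : continuous f ->
  (forall x, T x -> T (f x)) -> forall x, closure T x -> closure T (f x).
Proof.
move=> cf Tf x Tx B /cf /Tx[z [Tz Bz]].
by exists (f z); split => //; exact: Tf.
Qed.

Lemma dual_has_hole : has_hole (K `\` T).
Proof.
have v_w x z r : w (x + r *: v) z = w x z.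
  by rewrite /det3 !mxE; ring.
have w_v x z r : w z (x + r *: v) = w z x.
  by rewrite /det3 !mxE; ring.
have TK0 : K 0 by move=> x _; rewrite dot0r.
have T0 : T 0 by exists 0, 0 => //; rewrite mul0mx scale0r addr0.
rewrite /has_hole setDE interiorI interiorC -setDE.
have O_conv x z t : K° x -> K° z -> 0 <= t <= 1 -> K° ((1 - t) *: x + t *: z).
  rewrite !interior_polar => /= xK zK /andP[t0 t1] u us; rewrite dotDr !dotZr.
  have [->|tn0] := eqVneq t 0; first by rewrite subr0 mul1r mul0r addr0 xK.
  have : 0 < t by rewrite lt_neqAle eq_sym tn0.
  by have := xK u us; have := zK u us; nra.
have C_dir x r : closure T x -> closure T (x + r *: v).
  apply: (@closure_stable (fun x => x + r *: v)).
    by move=> z; exact: (cvgD (@cvg_id _ (nbhs z)) (@cvg_cst _ _ _ (nbhs z) _)).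
  by move=> _ [z [r' Kz ->]]; exists z, (r' + r) => //; rewrite scalerDl addrA.
have C_star x r : closure T x -> 0 <= r <= 1 -> closure T (r *: x).
  move=> Tx r01; apply: (@closure_stable (fun x => r *: x)) => //.
    by move=> z; exact: (cvgZl_tmp (@cvg_id _ (nbhs z))).
  move=> _ [z [r' Kz ->]]; exists (r *: z), (r * r').
    by have := polar_convex Kz TK0 r01; rewrite scaler0 addr0.
  by rewrite scalerDr scalemxAl scalerA.
(* A limit point exceeding [c] would have points of [T] near it exceeding [c]; the gap between [c]
   and the right-hand side restores strictness on the closure. *)
have C_inside i x : (i < n)%N -> closure T x -> w x (y i.+1) + w (y i) x < w (y i) (y i.+1).
  move=> iN Tx; have [c cw Kc] := shadow iN.
  apply: le_lt_trans cw; rewrite leNgt; apply/negP => cx.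
  pose h x := w (y i) x - w (y i.+1) x.
  have hE z : w z (y i.+1) + w (y i) z = h z by rewrite [w z _]det3C addrC.
  have ch : continuous h.
    by move=> z; exact: (cvgB (@det3_continuous _ v (y i) z) (@det3_continuous _ v (y i.+1) z)).
  rewrite hE in cx; have [z [[u [r Ku ->]]]] := Tx _ (cvgr_gt _ (ch x) _ cx).
  by rewrite /= -hE v_w w_v ltNge Kc.
have y_O i : (i <= n)%N -> K° (y i) by rewrite interior_polar => /y_inside.
have C0 : closure T 0 by exact: subset_closure.
split.
  exact: (@hole_connected R K° (closure T) v n a b y).
exact: (@hole_not_simply_connected R K° (closure T) v n a b y).
Qed.

Lemma dual_rupert P : dual_solid [set` s] P -> rupert P.
Proof.
move=> [k k0 [M [t [M_orth PE]]]].
have NM_orth : (N *m M) *m (N *m M)^T = 1%:M.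
  by rewrite trmx_mul -mulmxA (mulmxA M) M_orth mul1mx.
(* [N] acts before the similarity onto [P], so the whole configuration is the image under
   [sim k M t] of that of [dual_has_hole]. *)
pose Q := sim k (N *m M) t @` vertices K.
exists Q, (v *m M).
have PV : P = sim k M t @` vertices K by [].
have hP : convex_hull P = sim k M t @` K.
  by rewrite PV hull_image; [rewrite polar_hull|exact: sim_affine].
have hQ : convex_hull Q = sim k (N *m M) t @` K.
  by rewrite hull_image; [rewrite polar_hull|exact: sim_affine].
have kn0 : k != 0 by exact: lt0r_neq0.
split.
- exact: polyhedron_sim.
(* The isometry from [P] to [Q] is [N] conjugated by [M], with the translation that makes it fix
   [t], the image of the origin. *)
- exists (M^T *m N *m M), (t - t *m (M^T *m N *m M)); split.
    rewrite !trmx_mul trmxK -!mulmxA (mulmxA M) M_orth mul1mx (mulmxA N) N_orth.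
    by rewrite mul1mx (mulmx1C M_orth).
  rewrite PV image_comp /Q; apply: eq_imagel => x _ /=; rewrite /sim scale1r.
  rewrite mulmxDl -scalemxAl -!mulmxA (mulmxA M) M_orth mul1mx.
  by rewrite addrA addrAC addrK.
- apply/eqP => vM0; have : v = 0 by rewrite -[v]mulmx1 -M_orth mulmxA vM0 mul0mx.
  by move=> v0; move: w_0a; rewrite /det3 v0 !mxE !mul0r subr0 addr0 ltxx.
- have -> : convex_hull P `\` tube Q (v *m M) = sim k M t @` (K `\` T).
    have tubeE : tube Q (v *m M) = sim k M t @` T.
      rewrite /tube hQ; apply/seteqP; split => x.
        move=> [q [r [z Kz <-] ->]]; exists (z *m N + (r / k) *: v).
          by exists z, (r / k).
        rewrite /sim mulmxDl scalerDr -mulmxA -scalemxAl scalerA [k * _]mulrC divfK//.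
        by rewrite addrAC.
      move=> [_ [z [r Kz ->]] <-]; exists (sim k (N *m M) t z), (k * r).
        by exists z.
      by rewrite /sim mulmxDl scalerDr -mulmxA -scalemxAl scalerA addrAC.
    rewrite hP tubeE; apply/seteqP; split => x.
      move=> [[z Kz <-] nT]; exists z => //; split => // Tz; apply: nT.
    move=> [z [Kz nT] <-]; split; first by exists z.
    by move=> [u Tu /(can_inj (simK t k0 M_orth)) uz]; apply: nT; rewrite -uz.
  apply: (has_hole_image (g := sim_inv k M t)) dual_has_hole.
  + exact: sim_continuous.
  + exact: sim_inv_continuous.
  + exact: simK.
  + exact: sim_invK.
Qed.

End DualRupert.

(** * Exact certificates *)

(* The pair (p, q) stands for p + q sqrt d. *)
Definition zq : Type := (Z * Z)%type.
Definition quad (p q : Z) : zq := (p, q).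
Definition zv : Type := (zq * zq * zq)%type.

Section Quadratic.
Variable d : Z.
Implicit Types p q : zq.

Definition zint (z : Z) : zq := (z, Z0).
Definition zadd p q : zq := (Z.add p.1 q.1, Z.add p.2 q.2).
Definition zopp p : zq := (Z.opp p.1, Z.opp p.2).
Definition zsub p q : zq := zadd p (zopp q).
Definition zmul p q : zq :=
  (Z.add (Z.mul p.1 q.1) (Z.mul d (Z.mul p.2 q.2)), Z.add (Z.mul p.1 q.2) (Z.mul p.2 q.1)).
(** When [p] and [q] have opposite signs, the sign of [p + q sqrt d] is that of the term with the
    larger square. *)
Definition zpos p : bool :=
  let sq := Z.mul p.1 p.1 in let dsq := Z.mul d (Z.mul p.2 p.2) in
  [|| Z.ltb Z0 p.1 && Z.leb Z0 p.2, Z.ltb Z0 p.1 && Z.ltb dsq sq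
    | Z.ltb Z0 p.2 && Z.ltb sq dsq].
Definition znneg p : bool := zpos p || (p == (Z0, Z0)).

Definition zdot (u x : zv) : zq :=
  zadd (zadd (zmul u.1.1 x.1.1) (zmul u.1.2 x.1.2)) (zmul u.2 x.2).
Definition zcross (u x : zv) : zv :=
  (zsub (zmul u.1.2 x.2) (zmul u.2 x.1.2), zsub (zmul u.2 x.1.1) (zmul u.1.1 x.2),
   zsub (zmul u.1.1 x.1.2) (zmul u.1.2 x.1.1)).
Definition zdet (v u x : zv) : zq := zdot v (zcross u x).
Definition zvopp (u : zv) : zv := (zopp u.1.1, zopp u.1.2, zopp u.2).
Definition zvsub (u x : zv) : zv := (zsub u.1.1 x.1.1, zsub u.1.2 x.1.2, zsub u.2 x.2).

Variable R : realType.

Definition zR (z : Z) : R := (int_of_Z z)%:~R.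
Hypothesis d_ge0 : Z.le Z0 d.
Definition ev p : R := zR p.1 + zR p.2 * Num.sqrt (zR d).

Lemma zRD x y : zR (Z.add x y) = zR x + zR y.
Proof. by rewrite /zR -intrD -rmorphD. Qed.
Lemma zRN x : zR (Z.opp x) = - zR x.
Proof. by rewrite /zR -mulrNz -rmorphN. Qed.
Lemma zRM x y : zR (Z.mul x y) = zR x * zR y.
Proof. by rewrite /zR -intrM -rmorphM. Qed.
Lemma zR_ge0 x : Z.leb Z0 x -> 0 <= zR x.
Proof. by case: x => //= p _; rewrite /zR ler0z. Qed.
Lemma zR_gt0 x : Z.ltb Z0 x -> 0 < zR x.
Proof. by case: x => //= p _; rewrite /zR ltr0z /=; lia. Qed.
Lemma zR_lt x y : Z.ltb x y -> zR x < zR y.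
Proof.
move=> /Z.ltb_spec0 xy; rewrite -subr_gt0 -zRN -zRD; apply: zR_gt0.
by apply/Z.ltb_spec0; lia.
Qed.

Lemma evD p q : ev (zadd p q) = ev p + ev q.
Proof. by rewrite /ev /= !zRD; ring. Qed.
Lemma evN p : ev (zopp p) = - ev p.
Proof. by rewrite /ev /= !zRN; ring. Qed.
Lemma evB p q : ev (zsub p q) = ev p - ev q.
Proof. by rewrite /zsub evD evN. Qed.
Lemma ev_int z : ev (zint z) = zR z.
Proof. by rewrite /ev /= mul0r addr0. Qed.

Let root_sq : Num.sqrt (zR d) ^+ 2 = zR d.
Proof. by rewrite sqr_sqrtr// zR_ge0//; apply/Z.leb_spec0. Qed.

Lemma evM p q : ev (zmul p q) = ev p * ev q.
Proof.
rewrite /ev /= !zRD !zRM; move: (Num.sqrt _) root_sq => r <-; ring.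
Qed.

Lemma ev_gt0 p : zpos p -> 0 < ev p.
Proof.
rewrite /zpos /ev; have := sqrtr_ge0 (zR d).
move: (Num.sqrt _) root_sq => r rr r0 /or3P[] /andP[].
- move=> /zR_gt0 h1 /zR_ge0 h2.
  by rewrite ltr_pwDl// mulr_ge0.
- move=> /zR_gt0 h1 /zR_lt; rewrite !zRM -rr.
  rewrite (_ : r ^+ 2 * _ = (zR p.2 * r) ^+ 2); last by ring.
  by move: (zR p.2 * r) => t; rewrite -expr2; nra.
- move=> /zR_gt0 h1 /zR_lt; rewrite !zRM -rr.
  rewrite (_ : r ^+ 2 * _ = (zR p.2 * r) ^+ 2); last by ring.
  have : 0 <= zR p.2 * r by rewrite mulr_ge0// ltW.
  by move: (zR p.2 * r) => t; rewrite -expr2; nra.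
Qed.

Lemma ev_ge0 p : znneg p -> 0 <= ev p.
Proof.
move=> /orP[/ev_gt0/ltW//|/eqP->]; by rewrite /ev /= mul0r addr0.
Qed.

Definition mk3 (x y z : R) : 'rV[R]_3 := \row_i [:: x; y; z]`_i.
Definition evv (u : zv) := mk3 (ev u.1.1) (ev u.1.2) (ev u.2).

Lemma mk3E x y z : (mk3 x y z 0 i0 = x) * (mk3 x y z 0 i1 = y) * (mk3 x y z 0 i2 = z).
Proof. by rewrite !mxE. Qed.

Lemma ev_dot u x : ev (zdot u x) = dot (evv u) (evv x).
Proof. by rewrite dotE !mk3E /zdot !(evD, evM). Qed.

Lemma ev_det v u x : ev (zdet v u x) = det3 (evv v) (evv u) (evv x).
Proof. by rewrite /det3 !mk3E /zdet /zdot /zcross /= !(evD, evM, evB); ring. Qed.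

Lemma evvN u : evv (zvopp u) = - evv u.
Proof. by apply: row3P; rewrite !(mk3E, mxE) !evN. Qed.

End Quadratic.

Lemma dot_solve (R : realType) (x y z d : 'rV[R]_3) :
  dot x d = 0 -> dot y d = 0 -> dot z d = 0 -> det3 x y z != 0 -> d = 0.
Proof.
move=> dx dy dz D0.
pose cr (u v : 'rV[R]_3) := mk3 (u 0 i1 * v 0 i2 - u 0 i2 * v 0 i1)
  (u 0 i2 * v 0 i0 - u 0 i0 * v 0 i2) (u 0 i0 * v 0 i1 - u 0 i1 * v 0 i0).
have : det3 x y z *: d = dot x d *: cr y z + dot y d *: cr z x + dot z d *: cr x y.
  by apply: row3P; rewrite !mxE /= !dotE /det3; ring.
rewrite dx dy dz !scale0r !addr0 => /eqP; rewrite scaler_eq0 (negPf D0) /=.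
by move/eqP.
Qed.

Section MatrixOfRows.
Variable R : realType.
Implicit Types x y r : 'rV[R]_3.

Definition mxrows r0 r1 r2 : 'M[R]_3 := \matrix_(i, j) ([:: r0; r1; r2]`_i) 0 j.

Lemma sum3 (F : 'I_3 -> R) : \sum_i F i = F i0 + F i1 + F i2.
Proof.
rewrite !big_ord_recl big_ord0 addr0 addrA.
by congr (_ + _ + _); congr F; exact: val_inj.
Qed.

Lemma mulmx_mxrows x r0 r1 r2 :
  x *m mxrows r0 r1 r2 = x 0 i0 *: r0 + x 0 i1 *: r1 + x 0 i2 *: r2.
Proof. by apply/rowP => j; rewrite !mxE sum3 !mxE. Qed.

Lemma mxrows_orth r0 r1 r2 (c : R) :
  dot r0 r0 = c -> dot r1 r1 = c -> dot r2 r2 = c ->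
  dot r0 r1 = 0 -> dot r0 r2 = 0 -> dot r1 r2 = 0 ->
  mxrows r0 r1 r2 *m (mxrows r0 r1 r2)^T = c%:M.
Proof.
move=> h00 h11 h22 h01 h02 h12.
have e i j : (mxrows r0 r1 r2 *m (mxrows r0 r1 r2)^T) i j =
    dot ([:: r0; r1; r2]`_i) ([:: r0; r1; r2]`_j).
  by rewrite mxE; apply: eq_bigr => k _; rewrite !mxE.
apply/matrixP => i j; rewrite e mxE.
by move: i j; apply: ord3P; apply: ord3P; rewrite /= ?mulr1n ?mulr0n //= dotC.
Qed.

End MatrixOfRows.

Section Checker.
Variable d : Z.

Definition zv0 : zv := (zint Z0, zint Z0, zint Z0).

(* The second copy is rotated by the rational matrix [rows / den] and projected along
   [dir]; the polygon has vertices [loop / scale]; [faces] gives, for each edge of the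
   polygon, three normals of the solid whose cone contains the normal of that edge. *)
Record witness := Witness {
  rows : zv * zv * zv; den : Z; dir : zv; loop : seq zv; scale : Z;
  cut1 : nat; cut2 : nat; faces : seq (nat * nat * nat) }.

Variables (L : seq zv) (m : Z) (W : witness).

(** Repeating the first vertex at the end gives [y n = y 0] and spares the last edge any wrapping of
    indices. *)
Definition vertex i := nth zv0 (rcons (loop W) (head zv0 (loop W))) i.
Definition zw i j := zdet d (dir W) (vertex i) (vertex j).

Definition check_rows : bool :=
  let: (r0, r1, r2) := rows W in let c := zint (Z.mul (den W) (den W)) in
  [&& [&& zdot d r0 r0 == c, zdot d r1 r1 == c & zdot d r2 r2 == c],
      zdot d r0 r1 == zint Z0, zdot d r0 r2 == zint Z0 & zdot d r1 r2 == zint Z0].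

(** With [e] the edge vector, [det3 v x e] is the product of [x] with [e] cross [v]; taking products
    with the rows pulls this normal back to the unrotated solid, scaled by [den] and [scale]. *)
Definition edge_normal i : zv :=
  let c := zcross d (zvsub (vertex i.+1) (vertex i)) (dir W) in
  let: (r0, r1, r2) := rows W in (zdot d r0 c, zdot d r1 c, zdot d r2 c).

(* By Cramer's rule D u = D1 l1 + D2 l2 + D3 l3 for the normal u of the edge, so that
   <u, x> <= m (D1 + D2 + D3) / D on the solid. *)
Definition check_edge i : bool :=
  let: (t1, t2, t3) := nth (0, 0, 0)%N (faces W) i in
  let l1 := nth zv0 L t1 in let l2 := nth zv0 L t2 in let l3 := nth zv0 L t3 in
  let u := edge_normal i in
  let D := zdet d l1 l2 l3 in
  let D1 := zdet d u l2 l3 in let D2 := zdet d l1 u l3 in let D3 := zdet d l1 l2 u in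
  [&& zpos d (zw i i.+1), [&& t1 < size L, t2 < size L & t3 < size L]%N, zpos d D,
      [&& znneg d D1, znneg d D2 & znneg d D3]
    & zpos d (zsub (zmul d (zmul d D (zint (den W))) (zw i i.+1))
         (zmul d (zint (Z.mul (scale W) m)) (zadd (zadd D1 D2) D3)))].

Definition check_arc i j lo hi : bool :=
  zpos d (zw i j) && all (fun k => znneg d (zw i k) && zpos d (zopp (zw j k))) (iota lo (hi - lo)).

Definition check : bool :=
  [&& [&& Z.leb Z0 d, Z.ltb Z0 m, Z.ltb Z0 (den W) & Z.ltb Z0 (scale W)],
      check_rows,
      all (fun l => zvopp l \in L) L,
      all (fun y => all (fun l => zpos d (zsub (zint (Z.mul m (scale W))) (zdot d l y))) L) (loop W)
    & [&& all check_edge (iota 0 (size (loop W))),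
          [&& 0 < cut1 W, cut1 W < cut2 W & cut2 W < size (loop W)]%N,
          check_arc 0 (cut1 W) 0 (cut1 W),
          check_arc (cut1 W) (cut2 W) (cut1 W) (cut2 W)
        & check_arc (cut2 W) 0 (cut2 W) (size (loop W))]].

Variable R : realType.
Local Notation zR := (zR R).
Local Notation ev := (ev d R).
Local Notation evv := (evv d R).

Definition normals : seq 'rV[R]_3 := [seq (zR m)^-1 *: evv l | l <- L].

Lemma check_rupert P : check -> dual_solid [set` normals] P -> rupert P.
Proof.
case/and5P => /and4P[] /Z.leb_spec0 d0 /zR_gt0 -/(_ R) m0 /zR_gt0 -/(_ R) den0 /zR_gt0 -/(_ R) sc0.
move=> ck_rows /allP ck_sym /allP ck_in.
move=> /and5P[/allP ck_edge /and3P[c1 c12 c2] /andP[w01 arc0] /andP[w12 arc1] /andP[w20 arc2]].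
set n := size (loop W) in ck_edge c2 arc2 *.
have n0 : (0 < n)%N by exact: leq_trans c2.
pose y i : 'rV[R]_3 := (zR (scale W))^-1 *: evv (vertex i).
have sc_inv : 0 < (zR (scale W))^-1 by rewrite invr_gt0.
have wE i j : det3 (evv (dir W)) (y i) (y j) = (zR (scale W))^-2 * ev (zw i j).
  by rewrite /zw ev_det// /det3 !mxE; field; exact: lt0r_neq0.
have sc2 : 0 < (zR (scale W))^-2 by rewrite invr_gt0 exprn_gt0.
have w_gt0 i j : zpos d (zw i j) -> 0 < det3 (evv (dir W)) (y i) (y j).
  by move=> /(ev_gt0 R d0) h; rewrite wE mulr_gt0.
have arcP i j lo hi :
    all (fun k => znneg d (zw i k) && zpos d (zopp (zw j k))) (iota lo (hi - lo)) ->
    (lo <= hi)%N -> forall k, (lo <= k < hi)%N ->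
    0 <= det3 (evv (dir W)) (y i) (y k) /\ det3 (evv (dir W)) (y j) (y k) < 0.
  move=> /allP h lohi k kb; have := h k; rewrite mem_iota subnKC// => /(_ kb) /andP[].
  move=> /(ev_ge0 R d0) h1 /(ev_gt0 R d0); rewrite evN oppr_gt0 => h2.
  by rewrite !wE; split; [rewrite mulr_ge0// ltW|rewrite pmulr_rlt0].
have vertex_loop i : (i <= n)%N -> vertex i \in loop W.
  rewrite leq_eqVlt /vertex nth_rcons -/n => /orP[/eqP->|i_n]; last by rewrite i_n mem_nth.
  by rewrite ltnn eqxx -nth0 mem_nth.
have edgeP i : (i < n)%N -> check_edge i by move=> i_n; apply: ck_edge; rewrite mem_iota.
have K_le x l : polar_dual [set` normals] x -> l \in L -> dot (evv l) x <= zR m.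
  move=> Kx lL; have /Kx : [set` normals] ((zR m)^-1 *: evv l) by apply: map_f.
  by rewrite dotZl mulrC ler_pdivrMr// mul1r.
pose N : 'M[R]_3 := let: (r0, r1, r2) := rows W in
  (zR (den W))^-1 *: mxrows (evv r0) (evv r1) (evv r2).
apply: (@dual_rupert R normals N (evv (dir W)) n (cut1 W) (cut2 W) y) => //.
- move=> u u_le.
  have l_eq0 l : l \in L -> dot (evv l) u = 0.
    have le0 k : k \in L -> dot (evv k) u <= 0.
      move=> kL; have := u_le _ (map_f (fun l => (zR m)^-1 *: evv l) kL).
      by rewrite dotZl pmulr_rle0// invr_gt0.
    move=> lL; apply/le_anti; rewrite le0//=.
    by have := le0 _ (ck_sym _ lL); rewrite evvN dotNl oppr_le0.
  (* Symmetry of the normals turns the inequalities into equations; the positive determinant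
     certified at edge 0 provides three independent ones. *)
  have := edgeP _ n0; rewrite /check_edge; case: nth => -[t1 t2] t3.
  move=> /and5P[_ /and3P[t1L t2L t3L] /(ev_gt0 R d0) D0 _ _].
  move: D0; rewrite ev_det// => D0.
  apply: (dot_solve (l_eq0 _ (mem_nth zv0 t1L)) (l_eq0 _ (mem_nth zv0 t2L))
    (l_eq0 _ (mem_nth zv0 t3L))).
  exact: lt0r_neq0.
- move: ck_rows; rewrite /N /check_rows; case: (rows W) => -[r0 r1] r2.
  move=> /and4P[/and3P[/eqP h00 /eqP h11 /eqP h22] /eqP h01 /eqP h02 /eqP h12].
  have z0 : ev (zint Z0) = 0 by rewrite ev_int.
  have e u1 u2 c : zdot d u1 u2 = c -> dot (evv u1) (evv u2) = ev c.
    by move=> <-; rewrite ev_dot.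
  rewrite linearZ /= -scalemxAl -scalemxAr scalerA.
  rewrite (mxrows_orth (e _ _ _ h00) (e _ _ _ h11) (e _ _ _ h22)) ?(e _ _ _ h01)
    ?(e _ _ _ h02) ?(e _ _ _ h12)//.
  rewrite -[(ev _)%:M]scalemx1 scalerA ev_int zRM -invfM mulVf ?scale1r//.
  by rewrite mulf_neq0// lt0r_neq0.
- have ev_slack D dn w s m' p1 p2 p3 :
      ev (zsub (zmul d (zmul d D (zint dn)) w)
        (zmul d (zint (Z.mul s m')) (zadd (zadd p1 p2) p3))) =
      ev D * zR dn * ev w - zR s * zR m' * (ev p1 + ev p2 + ev p3).
    by rewrite evB !(evM R d0) !evD !ev_int zRM.
  move=> i i_n; have := edgeP _ i_n; rewrite /check_edge.
  case: nth => -[t1 t2] t3; set l1 := nth _ _ t1; set l2 := nth _ _ t2; set l3 := nth _ _ t3.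
  set u := edge_normal i.
  move=> /and5P[/(ev_gt0 R d0) w0 /and3P[t1L t2L t3L] /(ev_gt0 R d0) D0].
  move=> /and3P[/(ev_ge0 R d0) D1 /(ev_ge0 R d0) D2 /(ev_ge0 R d0) D3] /(ev_gt0 R d0).
  rewrite ev_slack subr_gt0 => lt_w.
  set e1 := ev (zdet d u l2 l3) in D1 lt_w *; set e2 := ev (zdet d l1 u l3) in D2 lt_w *.
  set e3 := ev (zdet d l1 l2 u) in D3 lt_w *; set D := ev (zdet d l1 l2 l3) in D0 lt_w *.
  (* The Cramer bound on [u], divided by the factor [den * scale] by which [u] exceeds the normal of
     the edge of [y] pulled back by [N]. *)
  exists (zR m * (e1 + e2 + e3) / (D * zR (den W) * zR (scale W))).
    rewrite wE ltr_pdivrMr ?mulr_gt0//.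
    rewrite -(ltr_pM2l sc0) [ltRHS](_ : _ = D * zR (den W) * ev (zw i i.+1)).
      by rewrite mulrA.
    by field; exact: lt0r_neq0.
  move=> x Kx.
  have uE : dot (evv u) x = zR (den W) * zR (scale W) *
      (det3 (evv (dir W)) (x *m N) (y i.+1) + det3 (evv (dir W)) (y i) (x *m N)).
    rewrite /u /edge_normal /N; case: (rows W) => -[r0 r1] r2.
    rewrite -scalemxAr mulmx_mxrows /y /det3 dotE !mk3E !(ev_dot R d0) !dotE.
    rewrite /zcross /zvsub /= !(mk3E, mxE) !(evB, evM R d0) /=.
    by field; rewrite !lt0r_neq0.
  have DuE : D * dot (evv u) x = e1 * dot (evv l1) x + e2 * dot (evv l2) x + e3 * dot (evv l3) x.
    rewrite /D /e1 /e2 /e3 !(ev_det R d0).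
    have := det3_cramer (evv l1) (evv l2) (evv l3) (evv u) => h.
    have := congr1 (fun z => dot x z) h; rewrite !dotDr !dotZr.
    by rewrite ![dot x _]dotC.
  rewrite ler_pdivlMr ?mulr_gt0//.
  rewrite [leLHS](_ : _ = D * dot (evv u) x); last by rewrite uE; ring.
  rewrite DuE; have h1 := K_le _ _ Kx (mem_nth zv0 t1L).
  have h2 := K_le _ _ Kx (mem_nth zv0 t2L); have h3 := K_le _ _ Kx (mem_nth zv0 t3L).
  rewrite [leRHS](_ : _ = e1 * zR m + e2 * zR m + e3 * zR m); last by ring.
  by rewrite !lerD// ler_wpM2l.
- move=> i i_n _ /mapP[l lL ->].
  have /allP/(_ _ lL) := ck_in _ (vertex_loop _ i_n).
  move=> /(ev_gt0 R d0); rewrite evB ev_int zRM (ev_dot R d0) subr_gt0.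
  rewrite /y dotZr dotZl => h.
  by rewrite mulrA -invfM mulrC ltr_pdivrMr ?mulr_gt0// mul1r [ltRHS]mulrC.
- rewrite /y /vertex !nth_rcons -/n ltnn eqxx n0.
  by rewrite -nth0.
- by move=> i /edgeP; rewrite /check_edge; case: nth => -[t1 t2] t3 /and5P[/w_gt0].
- exact: w_gt0.
- exact: w_gt0.
- exact: w_gt0.
- by move=> i i1; apply: (arcP _ _ _ _ arc0).
- by move=> i i1; apply: (arcP _ _ _ _ arc1) => //; exact: ltnW.
- by move=> i i1; apply: (arcP _ _ _ _ arc2) => //; exact: ltnW.
Qed.

End Checker.

(** * Signed permutations *)

Definition rotations (T : Type) (a b c : T) : seq (T * T * T) :=
  [:: (a, b, c); (b, c, a); (c, a, b)].
Definition odd_orders (T : Type) (a b c : T) : seq (T * T * T) := rotations a c b.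
Definition all_orders (T : Type) (a b c : T) : seq (T * T * T) :=
  rotations a b c ++ odd_orders a b c.

Definition perm_triple (T : Type) (s : 'S_3) (f : 'I_3 -> T) : T * T * T :=
  (f (s i0), f (s i1), f (s i2)).

Definition rot_perm : 'S_3 := (tperm i0 i1 * tperm i0 i2)%g.
Definition rot_perm2 : 'S_3 := (tperm i0 i2 * tperm i0 i1)%g.

Lemma perm3_mem (s : 'S_3) :
  s \in [:: 1%g; rot_perm; rot_perm2; tperm i1 i2; tperm i0 i2; tperm i0 i1].
Proof.
suff [p pL [p0 p1 p2]] : exists2 p,
    p \in [:: 1%g; rot_perm; rot_perm2; tperm i1 i2; tperm i0 i2; tperm i0 i1]
    & [/\ p i0 = s i0, p i1 = s i1 & p i2 = s i2].
  suff -> : s = p by [].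
  by apply/permP; apply: ord3P.
have := (inj_eq (@perm_inj _ s) i0 i1, inj_eq (@perm_inj _ s) i0 i2, inj_eq (@perm_inj _ s) i1 i2).
move: (s i0) (s i1) (s i2) => u v w.
move: u v w; do 3!apply: ord3P; move=> [[//= ? ?] ?] //.
(* Injectivity leaves six of the 27 triples of values, met in lexicographic order. *)
all: [> exists 1%g | exists (tperm i1 i2) | exists (tperm i0 i1) | exists rot_perm
  | exists rot_perm2 | exists (tperm i0 i2) ].
all: rewrite ?inE ?eqxx ?orbT //.
all: by split; rewrite /rot_perm /rot_perm2 ?permM !permE.
Qed.

Lemma perm_triple_values (T : Type) (f : 'I_3 -> T) :
  [/\ perm_triple 1%g f = (f i0, f i1, f i2),
      perm_triple rot_perm f = (f i1, f i2, f i0)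
    & perm_triple rot_perm2 f = (f i2, f i0, f i1)] /\
  [/\ perm_triple (tperm i1 i2) f = (f i0, f i2, f i1),
      perm_triple (tperm i0 i2) f = (f i2, f i1, f i0)
    & perm_triple (tperm i0 i1) f = (f i1, f i0, f i2)].
Proof. by rewrite /perm_triple /rot_perm /rot_perm2 !permM !permE /=; split. Qed.

(** The triple is a function of the index because its entries may coincide, in which case the values
    alone would not determine the permutation. *)
Definition orders_of (E : pred 'S_3) (ts : zq -> zq -> zq -> seq zv) : Prop :=
  forall (f : 'I_3 -> zq) (t : zv),
    t \in ts (f i0) (f i1) (f i2) <-> exists2 s, E s & t = perm_triple s f.

Lemma orders_even : orders_of [pred s | ~~ odd_perm s] (@rotations zq).
Proof.
move=> f t; have [[v1 vr vr2] [v12 v02 v01]] := perm_triple_values f; split.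
  rewrite !inE => /or3P[] /eqP->.
  - by exists 1%g; rewrite ?v1//= odd_perm1.
  - by exists rot_perm; rewrite ?vr//= odd_permM !odd_tperm.
  - by exists rot_perm2; rewrite ?vr2//= odd_permM !odd_tperm.
move=> [s sE ->]; have := perm3_mem s; rewrite !inE.
move=> /or4P[| | |/or3P[]] /eqP sp; move: sE; rewrite sp ?(v1, vr, vr2) ?eqxx ?orbT//;
  by rewrite /= odd_tperm.
Qed.

Lemma orders_odd : orders_of [pred s | odd_perm s] (@odd_orders zq).
Proof.
move=> f t; have [[v1 vr vr2] [v12 v02 v01]] := perm_triple_values f; split.
  rewrite !inE => /or3P[] /eqP->.
  - by exists (tperm i1 i2); rewrite ?v12//= odd_tperm.
  - by exists (tperm i0 i2); rewrite ?v02//= odd_tperm.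
  - by exists (tperm i0 i1); rewrite ?v01//= odd_tperm.
move=> [s sE ->]; have := perm3_mem s; rewrite !inE.
move=> /or4P[| | |/or3P[]] /eqP sp; move: sE; rewrite sp ?(v12, v02, v01) ?eqxx ?orbT//;
  by rewrite /= ?odd_permM ?odd_tperm ?odd_perm1.
Qed.

Lemma orders_all : orders_of predT (@all_orders zq).
Proof.
move=> f t; rewrite mem_cat; split.
  by move=> /orP[/orders_even|/orders_odd] [s _ ->]; exists s.
move=> [s _ ->]; apply/orP; have [so|se] := boolP (odd_perm s).
  by right; apply/orders_odd; exists s.
by left; apply/orders_even; exists s.
Qed.

Definition zsign (b : bool) (x : zq) : zq := if b then zopp x else x.
Definition signings (t : zv) : seq zv :=
  [seq (p.1, p.2, zsign e t.2) |
    p <- [seq (zsign e0 t.1.1, zsign e1 t.1.2) | e0 <- [:: false; true], e1 <- [:: false; true]],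
    e <- [:: false; true]].
Definition sign_orbit (ts : seq zv) : seq zv := flatten [seq signings t | t <- ts].

Lemma signingsP t u : reflect
  (exists e0 e1 e2, u = (zsign e0 t.1.1, zsign e1 t.1.2, zsign e2 t.2)) (u \in signings t).
Proof.
have allb (b : bool) : b \in [:: false; true] by case: b.
apply: (iffP allpairsP) => [[[p e] [pP _ ->]]|].
  by have /allpairsP[[e0 e1] [_ _ /= ->]] := pP; exists e0, e1, e.
move=> [e0 [e1 [e2 ->]]]; exists ((zsign e0 t.1.1, zsign e1 t.1.2), e2); split => //.
by apply/allpairsP; exists (e0, e1).
Qed.

Section Orbits.
Variables (R : realType) (d m : Z).
Hypothesis m_gt0 : 0 < zR R m.
Local Notation ev := (ev d R).
Local Notation normals_of L := (normals d L m R).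

Lemma normals_setU (A B : set 'rV[R]_3) L1 L2 :
  A = [set` normals_of L1] -> B = [set` normals_of L2] -> A `|` B = [set` normals_of (L1 ++ L2)].
Proof.
move=> -> ->; apply/seteqP; split => x /=; rewrite /normals map_cat mem_cat.
  by move=> [h|h]; apply/orP; [left|right].
by move=> /orP[h|h]; [left|right].
Qed.

(** Here [m] is a common denominator of the coordinates. The list may repeat normals, for instance
    when an entry is 0, but only membership matters. *)
Lemma signed_perms_orbit E ts (x y z : R) a b c : orders_of E ts ->
  ev a = x * zR R m -> ev b = y * zR R m -> ev c = z * zR R m ->
  signed_perms E x y z = [set` normals_of (sign_orbit (ts a b c))].
Proof.
move=> Ets ea eb ec.
pose f (i : 'I_3) := nth (zint Z0) [:: a; b; c] i.
have fE (i : 'I_3) : [:: x; y; z]`_i = (zR R m)^-1 * ev (f i).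
  have mn0 := lt0r_neq0 m_gt0.
  by move: i; apply: ord3P; rewrite /= ?(ea, eb, ec) mulrC mulfK.
have signE (e : bool) u : ev (zsign e u) = (-1) ^+ e * ev u.
  by case: e; rewrite /= ?evN ?expr1 ?mulN1r ?expr0 ?mul1r.
have key (s : 'S_3) (e : 'I_3 -> bool) :
    \row_(i < 3) ((-1) ^+ e i * [:: x; y; z]`_(s i)) =
    (zR R m)^-1 *: evv d R
      (zsign (e i0) (f (s i0)), zsign (e i1) (f (s i1)), zsign (e i2) (f (s i2))).
  by apply: row3P; rewrite !mxE /= signE fE mulrCA.
apply/seteqP; split => u /=.
  move=> [s [e Es ->]]; rewrite key; apply: map_f.
  apply/flatten_mapP; exists (perm_triple s f); first by apply/(Ets f); exists s.
  by apply/signingsP; exists (e i0), (e i1), (e i2).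
move=> /mapP[l /flatten_mapP[t /(Ets f)[s Es ->] /signingsP[e0 [e1 [e2 ->]]]] ->].
exists s; exists [ffun i : 'I_3 => [:: e0; e1; e2]`_i] => //.
by rewrite key !ffunE.
Qed.

End Orbits.

Definition zvec (x y z : Z) : zv := (zint x, zint y, zint z).

(** * The nine solids *)

(** The integer rows are orthogonal of common length 447. The loop consists of the vertices
    [(±1, 0, 0)], [(0, 0, ±1)] and four of [(±1/2, ±1/2, ±1/2)], shrunk by the factor 149/150 to
    become interior. The triples in [faces] are positions in the list of normals, repetitions
    included. *)
Definition rhombic_dodecahedron_witness : witness := Witness
  (zvec (-107) (-394) (-182),
   zvec 434 (-98) (-43),
   zvec (-2) (-187) 406) 447
  (zvec 5 (-10) 3)
  [:: zvec (-298) 0 0; zvec (-149) (-149) (-149); zvec 0 0 (-298);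
    zvec 149 149 (-149); zvec 298 0 0; zvec 149 149 149;
    zvec 0 0 298; zvec (-149) (-149) 149] 300
  2%N 5%N
  [:: (0, 2, 9); (0, 2, 9); (0, 9, 17); (0, 17, 4); (4, 6, 12);
    (4, 6, 12); (6, 18, 12); (2, 18, 6)]%N.

Definition triakis_octahedron_witness : witness := Witness
  (zvec 107 288 276,
   zvec 384 3 (-152),
   zvec (-108) 296 (-267)) 413
  (zvec 0 0 (-1))
  [:: zvec 118 0 0; zvec 59 (-59) 0; zvec 0 (-118) 0;
    zvec (-59) (-59) 0; zvec (-118) 0 0; zvec (-59) 59 0;
    zvec 0 118 0; zvec 59 59 0] 120
  2%N 5%N
  [:: (9, 13, 21); (9, 13, 21); (7, 15, 23); (7, 15, 23); (8, 18, 10);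
    (8, 18, 10); (0, 16, 8); (0, 16, 8)]%N.

Definition tetrakis_hexahedron_witness : witness := Witness
  (zvec 115 18 390,
   zvec 282 (-285) (-70),
   zvec 270 290 (-93)) 407
  (zvec (-3) 0 (-10))
  [:: zvec 299 0 0; zvec 199 (-199) (-199); zvec 0 (-299) 0;
    zvec (-199) (-199) 199; zvec (-299) 0 0; zvec (-199) 199 199;
    zvec 0 299 0; zvec 199 199 (-199)] 600
  2%N 5%N
  [:: (0, 24, 12); (8, 25, 12); (1, 3, 45); (3, 27, 14); (3, 10, 27);
    (10, 26, 14); (0, 2, 40); (0, 8, 24)]%N.

Definition deltoidal_icositetrahedron_witness : witness := Witness
  (zvec 2767 512 4076,
   zvec (-16) (-4913) 628,
   zvec 4108 (-364) (-2743)) 4953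
  (zvec 0 0 (-1))
  [:: zvec 289 0 0; zvec 205 (-205) 0; zvec 0 (-289) 0;
    zvec (-205) (-205) 0; zvec (-289) 0 0; zvec (-205) 205 0;
    zvec 0 289 0; zvec 205 205 0] 700
  2%N 5%N
  [:: (0, 16, 8); (0, 8, 12); (8, 13, 12); (5, 7, 21); (7, 15, 23);
    (3, 11, 15); (10, 14, 11); (0, 2, 18)]%N.

Definition disdyakis_dodecahedron_witness : witness := Witness
  (zvec 291 792 316,
   zvec (-568) (-69) 696,
   zvec 636 (-424) 477) 901
  (zvec (-11) (-11) (-50))
  [:: zvec 235 0 0; zvec 144 (-144) 0; zvec 0 (-235) 0;
    zvec (-124) (-124) 124; zvec (-235) 0 0; zvec (-144) 144 0;
    zvec 0 235 0; zvec 124 124 (-124)] 900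
  2%N 5%N
  [:: (6, 14, 30); (6, 46, 22); (4, 12, 36); (5, 37, 13); (1, 25, 9);
    (1, 17, 41); (3, 35, 11); (2, 10, 34)]%N.

Definition rhombic_triacontahedron_witness : witness := Witness
  (zvec 366 62 219,
   zvec 114 309 (-278),
   zvec (-197) 294 246) 431
  (zvec 7 87 100)
  [:: zvec (-555) 0 212; zvec (-555) (-343) 0; zvec (-343) (-343) 343;
    zvec 0 (-555) 343; zvec 343 (-343) 343; zvec 555 (-343) 0;
    zvec 555 0 (-212); zvec 555 343 0; zvec 343 343 (-343);
    zvec 0 555 (-343); zvec (-343) 343 (-343); zvec (-555) 343 0] 900
  2%N 7%N
  [:: (20, 62, 70); (10, 62, 63); (10, 62, 63); (16, 59, 67); (16, 59, 67);
    (16, 67, 65); (16, 65, 57); (8, 56, 57); (8, 56, 57); (20, 68, 60);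
    (20, 68, 60); (20, 70, 68)]%N.

Definition triakis_icosahedron_witness : witness := Witness
  (zvec 19954 954 297,
   zvec 18 (-6281) 18966,
   zvec 999 (-18942) (-6274)) 19979
  (zvec 0 7 20)
  [:: zvec (-1658) (-1025) 0; zvec 0 (-1658) 1025; zvec 1658 (-1025) 0;
    zvec 1658 1025 0; zvec 0 1658 (-1025); zvec (-1658) 1025 0] 6000
  2%N 4%N
  [:: (52, 60, 68); (0, 40, 48); (16, 17, 32); (51, 67, 59); (1, 55, 45);
    (20, 21, 38)]%N.

Definition pentakis_dodecahedron_witness : witness := Witness
  (zvec 1618 20106 9,
   zvec 5166 (-407) (-19494),
   zvec (-19431) 1566 (-5182)) 20171
  (zvec (-25) 2 0)
  [:: zvec 157 412 0; zvec 0 365 (-226); zvec 0 157 (-412);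
    zvec 0 (-157) (-412); zvec 0 (-365) (-226); zvec (-157) (-412) 0;
    zvec 0 (-365) 226; zvec 0 (-157) 412; zvec 0 157 412;
    zvec 0 365 226] 2000
  2%N 6%N
  [:: (8, 32, 56); (8, 33, 32); (0, 28, 24); (12, 36, 37); (12, 60, 36);
    (14, 63, 38); (14, 39, 38); (3, 31, 27); (10, 34, 35); (10, 34, 59)]%N.

Definition disdyakis_triacontahedron_witness : witness := Witness
  (zvec (-158307) (-183882) 58634,
   zvec 172254 (-100403) 150198,
   zvec (-87058) 135714 190563) 249623
  (zvec 1 0 0)
  [:: zvec 0 (-3248) 0; zvec 0 (-3000) (-1854); zvec 0 (-1180) (-3090);
    zvec 0 0 (-3248); zvec 0 1180 (-3090); zvec 0 3000 (-1854);
    zvec 0 3248 0; zvec 0 3000 1854; zvec 0 1180 3090;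
    zvec 0 0 3248; zvec 0 (-1180) 3090; zvec 0 (-3000) 1854] 15000
  2%N 7%N
  [:: (1, 113, 65); (1, 27, 3); (3, 55, 31); (11, 103, 51); (39, 63, 111);
    (78, 94, 86); (4, 68, 118); (4, 28, 6); (0, 24, 48); (8, 48, 96);
    (32, 104, 56); (73, 81, 89)]%N.

Section Solids.
Variable R : realType.
Local Notation Phi := (golden_ratio R).
Local Notation sqrt5 := (Num.sqrt 5 : R).

Lemma zRE : (zR R 0 = 0) * (zR R 1 = 1) * (zR R 2 = 2) * (zR R 3 = 3) * (zR R 4 = 4) *
  (zR R 5 = 5) * (zR R 6 = 6) * (zR R 7 = 7) * (zR R (-1) = -1) * (zR R (-2) = -2).
Proof. by []. Qed.

Lemma phi_inv : Phi^-1 = (sqrt5 - 1) / 2.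
Proof.
have s5 : sqrt5 ^+ 2 = 5 by rewrite sqr_sqrtr.
have s0 : 0 <= sqrt5 by exact: sqrtr_ge0.
have phi0 : Phi != 0 by rewrite lt0r_neq0// /golden_ratio; lra.
by apply: (mulIf phi0); rewrite mulVf// /golden_ratio; lra.
Qed.

Lemma phi_sq : Phi ^+ 2 = (3 + sqrt5) / 2.
Proof.
have s5 : sqrt5 ^+ 2 = 5 by rewrite sqr_sqrtr.
by rewrite /golden_ratio; lra.
Qed.

Lemma check_solid d m L W (A : set 'rV[R]_3) P :
  A = [set` normals d L m R] -> check d L m W -> dual_solid A P -> rupert P.
Proof. by move=> ->; exact: check_rupert. Qed.

Ltac orbit_normals orders :=
  apply: (signed_perms_orbit _ orders); rewrite ?zRE //;
  rewrite /ev /quad /= !zRE ?phi_inv ?phi_sq /golden_ratio; lra.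

Lemma rhombic_dodecahedron_rupert (P : set 'rV[R]_3) :
  rhombic_dodecahedron P -> rupert P.
Proof.
move=> dual_P; apply: (@check_solid 2 1
  (sign_orbit (all_orders (quad 1 0) (quad 1 0) (quad 0 0)))
  rhombic_dodecahedron_witness _ _ _ _ dual_P); last by vm_compute.
by orbit_normals orders_all.
Qed.

Lemma triakis_octahedron_rupert (P : set 'rV[R]_3) :
  triakis_octahedron P -> rupert P.
Proof.
move=> dual_P; apply: (@check_solid 2 1
  (sign_orbit (all_orders (quad 1 0) (quad 1 0) (quad (-1) 1)))
  triakis_octahedron_witness _ _ _ _ dual_P); last by vm_compute.
by orbit_normals orders_all.
Qed.

Lemma tetrakis_hexahedron_rupert (P : set 'rV[R]_3) :
  tetrakis_hexahedron P -> rupert P.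
Proof.
move=> dual_P; apply: (@check_solid 2 1
  (sign_orbit (all_orders (quad 0 0) (quad 1 0) (quad 2 0)))
  tetrakis_hexahedron_witness _ _ _ _ dual_P); last by vm_compute.
by orbit_normals orders_all.
Qed.

Lemma deltoidal_icositetrahedron_rupert (P : set 'rV[R]_3) :
  deltoidal_icositetrahedron P -> rupert P.
Proof.
move=> dual_P; apply: (@check_solid 2 1
  (sign_orbit (all_orders (quad 1 0) (quad 1 0) (quad 1 1)))
  deltoidal_icositetrahedron_witness _ _ _ _ dual_P); last by vm_compute.
by orbit_normals orders_all.
Qed.

Lemma disdyakis_dodecahedron_rupert (P : set 'rV[R]_3) :
  disdyakis_dodecahedron P -> rupert P.
Proof.
move=> dual_P; apply: (@check_solid 2 1
  (sign_orbit (all_orders (quad 1 0) (quad 1 1) (quad 1 2)))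
  disdyakis_dodecahedron_witness _ _ _ _ dual_P); last by vm_compute.
by orbit_normals orders_all.
Qed.

Lemma rhombic_triacontahedron_rupert (P : set 'rV[R]_3) :
  rhombic_triacontahedron P -> rupert P.
Proof.
(* The denominator is 4 because [Phi / 2] and [Phi ^+ 2 / 2] are [(1 + sqrt 5) / 4] and
   [(3 + sqrt 5) / 4]. *)
move=> dual_P; apply: (@check_solid 5 4
  (sign_orbit (all_orders (quad 0 0) (quad 0 0) (quad 2 2))
   ++ sign_orbit (rotations (quad 2 0) (quad 1 1) (quad 3 1)))
  rhombic_triacontahedron_witness _ _ _ _ dual_P); last by vm_compute.
apply: normals_setU; last by orbit_normals orders_even.
by orbit_normals orders_all.
Qed.

Lemma triakis_icosahedron_rupert (P : set 'rV[R]_3) :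
  triakis_icosahedron P -> rupert P.
Proof.
move=> dual_P; apply: (@check_solid 5 2
  ((sign_orbit (rotations (quad 0 0) (quad (-1) 1) (quad 5 1))
   ++ sign_orbit (rotations (quad (-1) 1) (quad 1 1) (quad 2 2)))
   ++ sign_orbit (rotations (quad 1 1) (quad 4 0) (quad 3 1)))
  triakis_icosahedron_witness _ _ _ _ dual_P); last by vm_compute.
apply: normals_setU; last by orbit_normals orders_even.
apply: normals_setU; last by orbit_normals orders_even.
by orbit_normals orders_even.
Qed.

Lemma pentakis_dodecahedron_rupert (P : set 'rV[R]_3) :
  pentakis_dodecahedron P -> rupert P.
Proof.
move=> dual_P; apply: (@check_solid 5 2
  ((sign_orbit (odd_orders (quad 0 0) (quad 2 0) (quad 3 3))
   ++ sign_orbit (odd_orders (quad 2 0) (quad 5 1) (quad 2 2)))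
   ++ sign_orbit (odd_orders (quad 1 1) (quad 4 0) (quad 4 2)))
  pentakis_dodecahedron_witness _ _ _ _ dual_P); last by vm_compute.
apply: normals_setU; last by orbit_normals orders_odd.
apply: normals_setU; last by orbit_normals orders_odd.
by orbit_normals orders_odd.
Qed.

Lemma disdyakis_triacontahedron_rupert (P : set 'rV[R]_3) :
  disdyakis_triacontahedron P -> rupert P.
Proof.
move=> dual_P; apply: (@check_solid 5 2
  ((((sign_orbit (rotations (quad (-1) 1) (quad (-1) 1) (quad 7 1))
   ++ sign_orbit (rotations (quad (-2) 2) (quad 1 1) (quad 4 2)))
   ++ sign_orbit (rotations (quad (-1) 1) (quad 3 1) (quad 1 3)))
   ++ sign_orbit (rotations (quad 0 2) (quad 4 0) (quad 5 1)))
   ++ sign_orbit (rotations (quad 1 1) (quad 6 0) (quad 2 2)))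
  disdyakis_triacontahedron_witness _ _ _ _ dual_P); last by vm_compute.
apply: normals_setU; last by orbit_normals orders_even.
apply: normals_setU; last by orbit_normals orders_even.
apply: normals_setU; last by orbit_normals orders_even.
apply: normals_setU; last by orbit_normals orders_even.
by orbit_normals orders_even.
Qed.

End Solids.
Theorem theorem3 (R : realType) (P : set 'rV[R]_3) :
  (rhombic_dodecahedron P -> rupert P) /\
  (triakis_octahedron P -> rupert P) /\
  (tetrakis_hexahedron P -> rupert P) /\
  (deltoidal_icositetrahedron P -> rupert P) /\
  (disdyakis_dodecahedron P -> rupert P) /\
  (rhombic_triacontahedron P -> rupert P) /\
  (triakis_icosahedron P -> rupert P) /\
  (pentakis_dodecahedron P -> rupert P) /\
  (disdyakis_triacontahedron P -> rupert P).
Proof.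
split; first exact: rhombic_dodecahedron_rupert.
split; first exact: triakis_octahedron_rupert.
split; first exact: tetrakis_hexahedron_rupert.
split; first exact: deltoidal_icositetrahedron_rupert.
split; first exact: disdyakis_dodecahedron_rupert.
split; first exact: rhombic_triacontahedron_rupert.
split; first exact: triakis_icosahedron_rupert.
split; first exact: pentakis_dodecahedron_rupert.
exact: disdyakis_triacontahedron_rupert.
Qed.
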